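(* The pseudo-circle is not homogeneous. That is, if $C$ is a pseudo-circle, then it is not the case that for every two points $x,y\in C$ there is a homeomorphism $h:C\to C$ of $C$ onto itself with $h(x)=y$.
   Context: A continuum is a nondegenerate (i.e. having more than one point) compact connected metric space. A continuum is indecomposable if it is not the union of two proper subcontinua, and hereditarily indecomposable if every subcontinuum of it is also indecomposable. A chain is a finite sequence of open sets $U_1,\dots,U_n$ with $U_i\cap U_j\neq\emptyset$ if and only if $|i-j|\le 1$; a circular chain is defined in the same way except that $U_1$ and $U_n$ also intersect. A continuum is chainable (respectively circularly chainable) if for every $\varepsilon>0$ it is covered by a chain (respectively circular chain) all of whose elements have diameter less than $\varepsilon$. A pseudo-arc is a hereditarily indecomposable chainable continuum. A pseudo-circle is a planar hereditarily indecomposable circularly chainable continuum which separates the plane and whose every proper subcontinuum is a pseudo-arc (it is known to be unique up to homeomorphism). A topological space $X$ is homogeneous if for any two points in $X$ there is a homeomorphism of $X$ onto itself mapping one point onto the other. *)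

(* Defs.v *)
From HB Require Import structures.
From mathcomp Require Import all_boot all_order all_algebra.
From mathcomp Require Import all_classical all_reals ereal topology normedtype.

Set Implicit Arguments.
Unset Strict Implicit.
Unset Printing Implicit Defensive.

Import Order.TTheory GRing.Theory Num.Theory.
Import numFieldNormedType.Exports.

Local Open Scope classical_set_scope.
Local Open Scope ring_scope.

(* Continua are represented as subsets of an ambient normed space, with the
   induced metric; for the ambient space used below this is the plane R * R,
   whose norm in the library is the maximum norm. It induces the usual topology
   and differs from the Euclidean norm by at most a factor sqrt 2, so that the
   conditions "of diameter less than e, for every e > 0" are unaffected. *)

Definition continuum (T : topologicalType) (A : set T) : Prop :=
  [/\ compact A, connected A & exists x y, [/\ A x, A y & x <> y]].

Definition subcontinuum (T : topologicalType) (A B : set T) : Prop :=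
  continuum B /\ B `<=` A.

Definition proper_subcontinuum (T : topologicalType) (A B : set T) : Prop :=
  subcontinuum A B /\ B <> A.

Definition indecomposable (T : topologicalType) (A : set T) : Prop :=
  ~ exists B1 B2 : set T, [/\ proper_subcontinuum A B1,
      proper_subcontinuum A B2 & A = B1 `|` B2].

Definition hereditarily_indecomposable (T : topologicalType) (A : set T)
    : Prop :=
  forall B : set T, subcontinuum A B -> indecomposable B.

Definition relatively_open (T : topologicalType) (A U : set T) : Prop :=
  exists2 O : set T, open O & U = A `&` O.

(* Links are indexed from 0, so the first and last ones are 0 and n.-1. *)
Definition chain (T : topologicalType) (A : set T) (n : nat)
    (U : 'I_n -> set T) : Prop :=
  (forall i, relatively_open A (U i)) /\
  (forall i j : 'I_n, U i `&` U j !=set0 <-> (`|i - j|%N <= 1)%N).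

Definition circular_chain (T : topologicalType) (A : set T) (n : nat)
    (U : 'I_n -> set T) : Prop :=
  (forall i, relatively_open A (U i)) /\
  (forall i j : 'I_n, U i `&` U j !=set0 <->
    [\/ (`|i - j|%N <= 1)%N,
        nat_of_ord i = 0%N /\ nat_of_ord j = n.-1
      | nat_of_ord i = n.-1 /\ nat_of_ord j = 0%N]).

Definition diam (R : realType) (V : normedModType R) (U : set V) : \bar R :=
  ereal_sup [set (`|x - y|)%:E | x in U & y in U].

Definition chainable (R : realType) (V : normedModType R) (A : set V) : Prop :=
  forall e : R, 0 < e -> exists (n : nat) (U : 'I_n -> set V),
    [/\ chain A U, A `<=` \bigcup_i U i & forall i, (diam (U i) < e%:E)%E].

Definition circularly_chainable (R : realType) (V : normedModType R)
    (A : set V) : Prop :=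
  forall e : R, 0 < e -> exists (n : nat) (U : 'I_n -> set V),
    [/\ circular_chain A U, A `<=` \bigcup_i U i
      & forall i, (diam (U i) < e%:E)%E].

Definition pseudo_arc (R : realType) (V : normedModType R) (A : set V) : Prop :=
  [/\ continuum A, hereditarily_indecomposable A & chainable A].

Definition separates_plane (R : realType) (C : set (R * R)) : Prop :=
  ~ connected (~` C).

Definition pseudo_circle (R : realType) (C : set (R * R)) : Prop :=
  [/\ continuum C, hereditarily_indecomposable C, circularly_chainable C,
      separates_plane C
    & forall K : set (R * R), proper_subcontinuum C K -> pseudo_arc K].

Definition homeomorphism (X Y : topologicalType) (h : X -> Y) : Prop :=
  continuous h /\
  exists g : Y -> X, [/\ continuous g, cancel h g & cancel g h].

Definition homogeneous (X : topologicalType) : Prop :=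
  forall x y : X, exists h : X -> X, homeomorphism h /\ h x = y.

(* Main.v *)
(* A circle-valued map on C is represented by a real function f that is continuous
   modulo 1; it is essential when it has no continuous real lift. Since C separates
   the plane, the angle f about a point of a bounded complementary domain is
   essential, and it defines an infinite cyclic cover of C. Every proper
   subcontinuum of C is chainable, hence lifts to the cover.
   The type of a point x records whether the lifts of f to the proper subcontinua
   through x are unbounded below, or above. Because C is circularly chainable, any
   two essential maps satisfy a relation "p f + q h is inessential" with nonzero
   integers p and q, so that, up to exchanging "below" and "above", homeomorphisms
   preserve types. There are points whose lifts are unbounded below but not above,
   and, using - f, points of the opposite type. If every point were of one of these
   two types, then by the Baire category theorem one of them would occupy a
   nonempty open set; the composant of each point meets that set, so the opposite
   type could not occur. *)
Require Import Defs.
From HB Require Import structures.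
From mathcomp Require Import all_boot all_order all_algebra.
From mathcomp Require Import all_classical all_reals ereal topology normedtype.
From mathcomp Require Import numfun lra ring zify.

Import Order.TTheory GRing.Theory Num.Theory.
Import numFieldNormedType.Exports.

Local Open Scope classical_set_scope.
Local Open Scope ring_scope.

Set Implicit Arguments.
Unset Strict Implicit.
Unset Printing Implicit Defensive.

(** * Continua in compact spaces *)

(** An essential map and its pullback under a homeomorphism are compared through their winding
    numbers [d], [d'] around one circular chain fine enough for both: [p = d'] and [q = - d]. The
    signs of these are not controlled, so the invariant is to have exactly one unbounded direction,
    and both types must enter the Baire argument. The one-sided points are found at the bottom end
    of the cover by a quasi-component argument: below a height [b], take the points that no clopen
    set bounded below separates from that end. From them continua descend arbitrarily far without
    exceeding [b]; they are graphs of lifts because no continuum in the cover projects onto the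
    whole space. Rising is excluded by nestedness: a continuum rising above [b] would be nested with
    one that stays below [b] and descends beneath its lowest point. For each [b] these points form a
    closed set, so integral heights exhibit either type as a countable union of closed sets. *)

Lemma directed_compact_meet (T : topologicalType) (W : set T) (F : set (set T)) :
  compact W -> F !=set0 -> (forall A, F A -> closed A) ->
  (forall A B, F A -> F B -> exists2 C, F C & C `<=` A `&` B) ->
  (forall A, F A -> W `&` A !=set0) ->
  exists2 x, W x & forall A, F A -> A x.
Proof.
move=> cW [A0 FA0] clF dF mF.
have FG : ProperFilter (filter_from F (fun A => W `&` A)).
  apply: filter_from_proper; last by move=> A /mF.
  apply: filter_from_filter; first by exists A0.
  move=> A B FA FB; have [C FC CAB] := dF _ _ FA FB.
  by exists C => // x [Wx /CAB[]].
have [|x [Wx clx]] := cW _ FG; first by exists A0 => // x [].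
exists x => // A FA; apply: (clF _ FA) => U /clx; apply.
by exists A => // y [].
Qed.

Lemma closed_setD (T : topologicalType) (A B : set T) :
  closed A -> open B -> closed (A `\` B).
Proof. by move=> clA oB; apply: closedI => //; exact: open_closedC. Qed.

Section connectedness.
Context {T : topologicalType}.
Implicit Types K A B : set T.

Lemma connected_sub_closed K A B : connected K -> closed A -> closed B ->
  K `<=` A `|` B -> K `&` A `&` B = set0 -> K `&` A !=set0 -> K `<=` A.
Proof.
move=> cK clA clB KAB K0 KA.
have -> : K = K `&` A; last by move=> x [].
apply/esym/cK => //; last by exists A.
exists (~` B); first exact: closed_openC.
rewrite eqEsubset; split => x [Kx Ax]; split => //.
  by move=> Bx; have : set0 x by rewrite -K0.
by have [] := KAB _ Kx.
Qed.

Lemma connected_closed_intro K : closed K ->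
  (forall A B, closed A -> closed B -> A `|` B = K -> A `&` B = set0 ->
     A !=set0 -> B = set0) -> connected K.
Proof.
move=> clK H B0 B0n [C oC eC] [D cD eD].
have h : K `&` ~` C = set0.
  apply: (H B0) => //.
  - by rewrite eD; apply: closedI.
  - by apply: closedI => //; exact: open_closedC.
  - by rewrite eC -setIUr setUv setIT.
  - by rewrite eC setIACA setICr setI0.
rewrite eC; rewrite eqEsubset; split => x; first by case.
move=> Kx; split=> //; apply: contrapT => nC.
by have : set0 x by rewrite -h.
Qed.

End connectedness.

(** Unlike [continuum], this admits singletons and the empty set, so that intersections and
    one-point lifts need no nondegeneracy check. *)
Definition cpt_conn (T : topologicalType) (K : set T) := compact K /\ connected K.

Lemma cpt_conn1 (T : topologicalType) (x : T) : cpt_conn [set x].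
Proof. by split; [exact: compact_set1|exact: connected1]. Qed.

Section continua.
Context {R : realType} {T : pseudoMetricType R}.
Hypothesis hT : hausdorff_space T.
Implicit Types K W A B E S : set T.

Lemma closed_separation A B : closed A -> closed B -> A `&` B = set0 ->
  exists U V, [/\ open U, open V, A `<=` U, B `<=` V & U `&` V = set0].
Proof. by have /(@normal_openP R) := @pseudometric_normal R T; apply. Qed.

(** If the intersection split into two disjoint closed sets, disjoint open neighbourhoods of these
    would, by compactness, already cover some member of [F], which the last hypothesis forbids. This
    form serves both chains of continua and the clopen sets that define a quasi-component. *)
Lemma directed_connected (W : set T) (F : set (set T)) :
  compact W -> F !=set0 -> (forall A, F A -> closed A /\ A `<=` W) ->
  (forall A B, F A -> F B -> exists2 C, F C & C `<=` A `&` B) ->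
  (forall A U V, F A -> open U -> open V -> U `&` V = set0 -> A `<=` U `|` V ->
    \bigcap_(B in F) B `&` U !=set0 -> \bigcap_(B in F) B `&` V !=set0 ->
    False) ->
  cpt_conn (\bigcap_(A in F) A).
Proof.
move=> cW [A0 FA0] clF dF sF.
have cl : closed (\bigcap_(A in F) A) by apply: closed_bigI => A /clF[].
have sub : \bigcap_(A in F) A `<=` W by move=> x /(_ _ FA0); case: (clF _ FA0) => _; apply.
split; first exact: subclosed_compact sub.
apply: connected_closed_intro => // A B clA clB eAB AB0 [a Aa].
apply: contrapT => /eqP/set0P[b Bb].
have [U [V [oU oV AU BV UV0]]] := closed_separation clA clB AB0.
pose G := [set D `\` (U `|` V) | D in F].
have [||||x Wx Gx] := @directed_compact_meet _ W G cW.
- by exists (A0 `\` (U `|` V)); exists A0.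
- move=> _ [D FD <-]; apply: closed_setD; first by case: (clF _ FD).
  exact: openU.
- move=> _ _ [D FD <-] [D' FD' <-]; have [C FC CD] := dF _ _ FD FD'.
  by exists (C `\` (U `|` V)); [exists C|move=> x [/CD[? ?] ?]].
- move=> _ [D FD <-]; apply: contrapT => h.
  apply: (sF D U V) => //; last 2 first.
  + by exists a; split; [rewrite -eAB; left|apply: AU].
  + by exists b; split; [rewrite -eAB; right|apply: BV].
  move=> x Dx; apply: contrapT => nUV; apply: h; exists x; split => //.
  by case: (clF _ FD) => _; apply.
have : (A `|` B) x.
  rewrite eAB => D FD.
  by have /(_ (D `\` (U `|` V)))[|] := Gx; first by exists D.
have : ~ (U `|` V) x by case: (Gx (A0 `\` (U `|` V))) => //; exists A0.
by move=> nUV [/AU|/BV] h; apply: nUV; [left|right].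
Qed.

Lemma chain_cpt_conn (F : set (set T)) : F !=set0 ->
  (forall A, F A -> cpt_conn A) -> total_on F subset ->
  cpt_conn (\bigcap_(A in F) A).
Proof.
move=> [A0 FA0] cF tF.
pose F' := [set A | F A /\ A `<=` A0].
have eF : \bigcap_(A in F) A = \bigcap_(A in F') A.
  rewrite eqEsubset; split=> x h A; first by move=> [FA _]; exact: h.
  by move=> FA; case: (tF _ _ FA FA0) => s; [exact: h|apply: s; apply: (h A0); split].
rewrite eF; apply: (@directed_connected A0).
- by case: (cF _ FA0).
- by exists A0; split.
- by move=> A [FA AA0]; split => //; apply: compact_closed => //; case: (cF _ FA).
- move=> A B FA FB.
  by case: (tF A B FA.1 FB.1) => s; [exists A|exists B] => // x h; split => //; exact: s.
- move=> A U V FA oU oV UV0 AUV [u [uA Uu]] [v [vA Vv]].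
  have h : A `&` U = A.
    case: (cF _ FA.1) => _; apply.
    - by exists u; split => //; exact: uA.
    - by exists U.
    - exists (~` V); first exact: open_closedC.
      rewrite eqEsubset; split=> x [Ax Ux]; split=> //.
        by move=> Vx; have : set0 x by rewrite -UV0.
      by case: (AUV _ Ax).
  have : set0 v by rewrite -UV0; split => //; have := vA _ FA; rewrite -{1}h => -[].
  by [].
Qed.

(** The continuum is the quasi-component of [z] in [W], the intersection of all relatively clopen
    sets through [z]; it meets [S] by compactness because each of them does. *)
Lemma continuum_to_closed W S z : compact W -> W z -> closed S ->
  (forall E, closed E -> closed (W `\` E) -> E `<=` W -> E z -> E `&` S !=set0) ->
  exists K, [/\ cpt_conn K, K `<=` W, K z & K `&` S !=set0].
Proof.
move=> cW Wz clS H; have clW := compact_closed hT cW.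
pose F := [set E | [/\ closed E, closed (W `\` E), E `<=` W & E z]].
have FW : F W by split => //; rewrite setDv; exact: closed0.
have dF A B : F A -> F B -> F (A `&` B).
  move=> [A1 A2 A3 A4] [B1 B2 B3 B4]; split => //; first exact: closedI.
    by rewrite setDIr; apply: closedU.
  by move=> x [/A3].
exists (\bigcap_(E in F) E); split.
- apply: (@directed_connected W) => //; first by exists W.
  + by move=> A [].
  + by move=> A B FA FB; exists (A `&` B) => //; exact: dF.
  (* Removing the [V] side from [A] leaves a relatively clopen set through [z], so the whole
     intersection lies on the side of [z]. *)
  + have key A U V : F A -> open U -> open V -> U `&` V = set0 ->
        A `<=` U `|` V -> U z -> \bigcap_(B in F) B `<=` U.
      move=> [A1 A2 A3 A4] oU oV UV0 AUV Uz.
      have FAV : F (A `\` V).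
        split=> //.
        * by apply: closed_setD.
        * have -> : W `\` (A `\` V) = (W `\` A) `|` (A `\` U); last first.
            by apply: closedU => //; apply: closed_setD.
          rewrite eqEsubset; split => x.
            move=> [Wx nAV]; have [Ax|nAx] := pselect (A x); last by left.
            right; split=> // Ux; apply: nAV; split=> // Vx.
            by have : set0 x by rewrite -UV0.
          case=> -[]; first by move=> ? ?; split => // -[].
          by move=> Ax nU; split; [exact: A3|case; case: (AUV _ Ax)].
        * by move=> x [/A3].
        * by split=> // Vz; have : set0 z by rewrite -UV0.
      by move=> x /(_ _ FAV) [Ax nVx]; case: (AUV _ Ax).
    move=> A U V FA oU oV UV0 AUV [u [uF Uu]] [v [vF Vv]].
    have [Uz|Vz] : (U `|` V) z by apply: AUV; case: FA.
      have Uv := key _ _ _ FA oU oV UV0 AUV Uz v vF.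
      by have : set0 v by rewrite -UV0.
    have Vu : V u by apply: (key A V U) => //; rewrite 1?setIC// setUC.
    by have : set0 u by rewrite -UV0.
- by move=> x /(_ _ FW).
- by move=> A [].
- pose G := [set E `&` S | E in F].
  have [||||x Wx Gx] := @directed_compact_meet _ W G cW.
  + by exists (W `&` S); exists W.
  + by move=> _ [E [clE _ _ _] <-]; exact: closedI.
  + move=> _ _ [A FA <-] [B FB <-]; exists (A `&` B `&` S).
      by exists (A `&` B) => //; exact: dF.
    by move=> x [[]].
  + move=> _ [E [E1 E2 E3 E4] <-]; have [x [Ex Sx]] := H _ E1 E2 E3 E4.
    by exists x; split => //; exact: E3.
  exists x; split; last by have /(_ (W `&` S))[|] := Gx; first by exists W.
  by move=> E FE; have /(_ (E `&` S))[|] := Gx; first by exists E.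
Qed.

(** Boundary bumping. With [w] in [U] and [~ O] inside [V], a clopen part of [Q] minus [U] that
    contains [z] and lies inside [V] would be clopen in [Q]; so some continuum through [z] leaves
    [V], and it is proper because it omits [w]. *)
Lemma composant_meets_open (Q O : set T) z w : cpt_conn Q -> open O ->
  Q z -> Q w -> O w -> ~ O z ->
  exists A, [/\ cpt_conn A, A `<=` Q, A z, A <> Q & A `&` O !=set0].
Proof.
move=> [cQ kQ] oO Qz Qw Ow nOz.
have clQ := compact_closed hT cQ.
have [|||U [V [oU oV wU OV UV0]]] := @closed_separation [set w] (~` O).
- by apply: (compact_closed hT); exact: compact_set1.
- exact: open_closedC.
- by rewrite -subset0 => _ [-> ].
have Uw : U w by exact: wU.
have clV : closed (~` V) by exact: open_closedC.
have [||||K [cK KW Kz [x [Kx nVx]]]] := @continuum_to_closed (Q `\` U) (~` V) z.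
- by apply: subclosed_compact (closed_setD _ _) cQ _ => // x [].
- by split=> // Uz; have : set0 z by rewrite -UV0; split=> //; exact: OV.
- by [].
- move=> E clE clWE EW Ez; apply: contrapT => nE.
  have EV x : E x -> V x by move=> Ex; apply: contrapT => nV; apply: nE; exists x.
  have : Q `<=` E.
    apply: (@connected_sub_closed _ Q E ((Q `\` U `\` E) `|` (Q `\` V))) => //.
    + by apply: closedU => //; exact: closed_setD.
    + move=> x Qx; have [Ex|nEx] := pselect (E x); first by left.
      right; have [Ux|nUx] := pselect (U x); last by left.
      by right; split=> // Vx; have : set0 x by rewrite -UV0.
    + rewrite -subset0 => x [[Qx Ex] [[_ []]//|[_]]]; apply; exact: EV.
    + by exists z.
  by move=> /(_ _ Qw) /EW[].
exists K; split => //.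
- by move=> y /KW[].
- by move=> eK; have /KW[_] : K w by rewrite eK.
- by exists x; split => //; apply: contrapT => nOx; exact/nVx/OV.
Qed.

(** If neither contains the other, boundary bumping yields proper parts of [Q] and [Q'] through [z],
    the one leaving [Q'] and the other leaving [Q], and these are not nested. *)
Lemma nested_from_proper (Q Q' : set T) z : cpt_conn Q -> cpt_conn Q' ->
  Q z -> Q' z ->
  (forall A B, cpt_conn A -> cpt_conn B -> A `<=` Q -> B `<=` Q' -> A z -> B z ->
     A <> Q -> B <> Q' -> A `<=` B \/ B `<=` A) ->
  Q `<=` Q' \/ Q' `<=` Q.
Proof.
move=> cQ cQ' Qz Q'z H.
have [|nQ] := pselect (Q `<=` Q'); [by left|right].
have clQ := compact_closed hT cQ.1; have clQ' := compact_closed hT cQ'.1.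
have [w [Qw nQ'w]] : exists w, Q w /\ ~ Q' w.
  apply: contrapT => h; apply: nQ => w Qw; apply: contrapT => nw.
  by apply: h; exists w.
have [||A [cA AQ Az nAQ [x [Ax nQ'x]]]] :=
    composant_meets_open cQ (closed_openC clQ') Qz Qw => //.
move=> w' Q'w'; apply: contrapT => nQw'.
have [||B [cB BQ' Bz nBQ' [y [By nQy]]]] :=
    composant_meets_open cQ' (closed_openC clQ) Q'z Q'w' => //.
case: (H A B) => // s; first exact/nQ'x/BQ'/s.
exact/nQy/AQ/s.
Qed.

Lemma minimal_continuum (P : set (set T)) (Q0 : set T) :
  cpt_conn Q0 -> P Q0 ->
  (forall F : set (set T), F !=set0 -> (forall A, F A -> cpt_conn A /\ P A) ->
     total_on F subset -> P (\bigcap_(A in F) A)) ->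
  exists Q, [/\ cpt_conn Q, P Q &
    forall A, cpt_conn A -> P A -> A `<=` Q -> A = Q].
Proof.
move=> cQ0 PQ0 H.
pose I := {Q : set T | cpt_conn Q /\ P Q}.
have [||||[Q [cQ PQ]] mQ] := @Zorn I (fun A B : I => `[< sval B `<=` sval A >]).
- by move=> ?; apply/asboolP.
- by move=> A B C /asboolP AB /asboolP BC; apply/asboolP => x /BC/AB.
- move=> [A hA] [B hB] /asboolP/= AB /asboolP/= BA; apply: eq_exist => /=.
  by rewrite eqEsubset.
- move=> F tF; have [[A0 FA0]|F0] := pselect (F !=set0); last first.
    by exists (exist _ Q0 (conj cQ0 PQ0)) => A FA; exfalso; apply: F0; exists A.
  pose F' := [set sval A | A in F].
  have F'0 : F' !=set0 by exists (sval A0); exists A0.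
  have F'P A : F' A -> cpt_conn A /\ P A by move=> [[B hB] _ <-].
  have tF' : total_on F' subset.
    by move=> _ _ [A FA <-] [B FB <-]; case: (tF _ _ FA FB) => /asboolP; [right|left].
  have cI : cpt_conn (\bigcap_(A in F') A) /\ P (\bigcap_(A in F') A).
    split; last exact: H.
    by apply: chain_cpt_conn => // A /F'P[].
  exists (exist (fun Q => cpt_conn Q /\ P Q) _ cI) => A FA; apply/asboolP => /= x; apply; by exists A.
exists Q; split=> // A cA PA AQ.
have := mQ (exist (fun Q => cpt_conn Q /\ P Q) A (conj cA PA)) => /(_ _)/(congr1 sval)/= -> //.
exact/asboolP.
Qed.

End continua.

(** If no [F n] had interior, every nonempty open set would contain the closure of a smaller one
    missing [F n]; the closures so obtained successively have a common point outside every [F n]. *)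
Lemma compact_baire (R : realType) (T : pseudoMetricType R) (F : nat -> set T) :
  hausdorff_space T -> compact [set: T] -> [set: T] !=set0 ->
  (forall n, closed (F n)) -> \bigcup_n F n = setT ->
  exists n O, [/\ open O, O !=set0 & O `<=` F n].
Proof.
move=> hT cT [t0 _] clF FT; apply: contrapT => hn.
have step n (O : set T) : open O -> O !=set0 ->
    exists O', [/\ open O', O' !=set0, closure O' `<=` O & closure O' `<=` ~` F n].
  move=> oO O0.
  have [w [Ow nFw]] : exists w, O w /\ ~ F n w.
    apply: contrapT => h; apply: hn; exists n, O; split=> // w Ow.
    by apply: contrapT => nw; apply: h; exists w.
  have [|||U [V [oU oV wU OV UV0]]] := @closed_separation _ _ [set w] (~` (O `\` F n)).
  - by apply: (compact_closed hT); exact: compact_set1.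
  - by apply: open_closedC; apply: openI => //; exact: closed_openC.
  - by rewrite -subset0 => _ [-> []].
  have clU : closure U `<=` O `\` F n.
    move=> x clx; apply: contrapT => nx.
    have [y [Uy Vy]] := clx V (open_nbhs_nbhs (conj oV (OV _ nx))).
    by have : set0 y by rewrite -UV0.
  exists U; split=> //; first by exists w; exact: wU.
  - by move=> x /clU[].
  - by move=> x /clU[].
pose P (O : set T) := open O /\ O !=set0.
pose I := {O : set T | P O}.
have /choice[f fP] : forall nO : nat * I, exists O' : I,
    closure (sval O') `<=` sval nO.2 /\ closure (sval O') `<=` ~` F nO.1.
  move=> [n [O [oO O0]]]; have [O' [oO' nO' c1 c2]] := step n O oO O0.
  by exists (exist P O' (conj oO' nO')).
have PT : P setT by split; [exact: openT|exists t0].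
pose g := fix g n := if n is m.+1 then f (m, g m) else exist P setT PT.
have gle m n : sval (g (n + m)%N) `<=` sval (g m).
  elim: n => // n IH; apply: subset_trans IH => x h.
  by case: (fP ((n + m)%N, g (n + m)%N)) => s _; apply/s/subset_closure.
have [||||x _ Gx] := @directed_compact_meet _ setT [set closure (sval (g n)) | n in setT] cT.
- by exists (closure (sval (g 0))); exists 0.
- by move=> _ [n _ <-]; exact: closed_closure.
- move=> _ _ [n _ <-] [m _ <-]; exists (closure (sval (g (n + m)%N))).
    by exists (n + m)%N.
  move=> x h; split; last exact: (closureS (@gle m n)).
  by apply: (closureS (@gle n m)); rewrite addnC.
- move=> _ [n _ <-]; case: (g n) => O /= [oO [x Ox]].
  by exists x; split=> //; exact: subset_closure.
have : (\bigcup_n F n) x by rewrite FT.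
move=> [n _ Fnx]; case: (fP (n, g n)) => _ /(_ x); apply => //.
by apply: (Gx (closure (sval (g n.+1)))); exists n.+1.
Qed.

(** * Circle-valued maps and their lifts *)

(** Distance less than [e] from 0 on the circle of reals modulo 1, expressed on representatives. *)
Definition near_int (R : realType) (e r : R) :=
  exists2 k, k \is a Num.int & `|r - k| < e.

Definition cont_on (R : realType) (X : topologicalType) (K : set X) (g : X -> R) :=
  forall x, K x -> forall e, 0 < e -> \forall y \near x, K y -> `|g y - g x| < e.

Definition cont_mod1 (R : realType) (X : topologicalType) (K : set X) (f : X -> R) :=
  forall x, K x -> forall e, 0 < e -> \forall y \near x, K y -> near_int e (f y - f x).

Definition is_lift (R : realType) (X : topologicalType) (K : set X) (f g : X -> R) :=
  cont_on K g /\ forall x, K x -> g x - f x \is a Num.int.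

Definition liftable (R : realType) (X : topologicalType) (K : set X) (f : X -> R) :=
  exists g, is_lift K f g.

Section near_int.
Context {R : realType}.
Implicit Types e r s k c : R.

Lemma int_small k : k \is a Num.int -> `|k| < 1 -> k = 0.
Proof.
move=> /intrP[n ->]; rewrite -intr_norm -[1]/(1%:~R) ltr_int => h.
by have -> : n = 0 by lia.
Qed.

Lemma int_close r s : r - s \is a Num.int -> `|r - s| < 1 -> r = s.
Proof. by move=> i l; apply/eqP; rewrite -subr_eq0 (int_small i l). Qed.

Lemma near_intN e r : near_int e r -> near_int e (- r).
Proof.
by move=> [k ki h]; exists (- k); rewrite ?rpredN // -opprD normrN.
Qed.

Lemma near_intD e e' r s : near_int e r -> near_int e' s -> near_int (e + e') (r + s).
Proof.
move=> [k ki h] [l li h']; exists (k + l); first exact: rpredD.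
by rewrite opprD addrACA (le_lt_trans (ler_normD _ _)) // ltrD.
Qed.

Lemma near_int_addint e r k : k \is a Num.int -> near_int e r -> near_int e (r + k).
Proof.
move=> ki [l li h]; exists (l + k); first exact: rpredD.
by rewrite opprD addrACA subrr addr0.
Qed.

Lemma near_int_small e r : e <= 1/2 -> `|r| <= 1/2 -> near_int e r -> `|r| < e.
Proof.
move=> e2 r2 [k ki h]; suff k0 : k = 0 by rewrite k0 subr0 in h.
apply: int_small => //; have -> : k = r - (r - k) by rewrite subKr.
by have := ler_normB r (r - k); lra.
Qed.

Lemma near_int_rep e r c : near_int e (r - c) ->
  exists2 s, s - r \is a Num.int & `|s - c| < e.
Proof.
move=> [k ki h]; exists (r - k); last by rewrite addrAC.
by rewrite addrAC subrr add0r rpredN.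
Qed.

End near_int.

Section circle_maps.
Context {R : realType} {X : topologicalType}.
Implicit Types (K L : set X) (f g h : X -> R).

Lemma cont_onS K L g : K `<=` L -> cont_on L g -> cont_on K g.
Proof.
move=> KL h x Kx e e0; apply: filterS (h x (KL _ Kx) e e0) => y hy Ky.
exact/hy/KL.
Qed.

Lemma cont_mod1S K L f : K `<=` L -> cont_mod1 L f -> cont_mod1 K f.
Proof.
move=> KL h x Kx e e0; apply: filterS (h x (KL _ Kx) e e0) => y hy Ky.
exact/hy/KL.
Qed.

Lemma is_liftS K L f g : K `<=` L -> is_lift L f g -> is_lift K f g.
Proof. by move=> KL [c i]; split; [exact: cont_onS KL c|move=> x /KL/i]. Qed.

Lemma cont_onP K g : cont_on K g <-> {within K, continuous g}.
Proof.
split=> [h|/subspace_continuousP h x Kx e e0].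
  apply/subspace_continuousP => x Kx; apply/cvgrPdist_lt => e e0.
  rewrite near_withinE; apply: filterS (h x Kx e e0) => y hy Ky.
  by rewrite distrC; exact: hy.
have /cvgrPdist_lt/(_ e e0) := h x Kx.
by rewrite near_withinE; apply: filterS => y hy Ky; rewrite distrC; exact: hy.
Qed.

Lemma cont_on_cst K (c : R) : cont_on K (fun=> c).
Proof. by move=> x _ e e0; apply: nearW => y _; rewrite subrr normr0. Qed.

Lemma cont_on_lin K g h (p q : R) : cont_on K g -> cont_on K h ->
  cont_on K (fun x => p * g x + q * h x).
Proof.
move=> cg ch x Kx e e0.
have d0 : 0 < e / (`|p| + `|q| + 1) by rewrite divr_gt0 // ltr_wpDl // addr_ge0.
apply: filterS2 (cg x Kx _ d0) (ch x Kx _ d0) => y /[swap] h2 h1 Ky.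
move: (h1 Ky) (h2 Ky); rewrite !ltr_pdivlMr ?ltr_wpDl ?addr_ge0 // => {}h1 {}h2.
rewrite opprD addrACA -!mulrBr (le_lt_trans (ler_normD _ _)) // !normrM.
have := normr_ge0 p; have := normr_ge0 q.
have := normr_ge0 (g y - g x); have := normr_ge0 (h y - h x).
move: h1 h2; set a := `|g y - g x|; set b := `|h y - h x|; set P := `|p|; set Q := `|q|.
move=> h1 h2 b0 a0 Q0 P0.
have [ab|ba] := leP a b; first by nra.
by nra.
Qed.

Lemma cont_on_bounded K g : compact K -> cont_on K g ->
  exists M, forall x, K x -> `|g x| <= M.
Proof.
move=> cK /cont_onP cg; have /compact_bounded[M [Mr h]] := continuous_compact cg cK.
by exists (M + 1) => x Kx; apply: (h (M + 1)); rewrite ?ltrDl //; exists x.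
Qed.

(** A difference of at most 1/2 cannot hide a nonzero integer, so this crude bound on [g] turns the
    continuity of [f] modulo 1 into continuity of [g]. *)
Lemma lift_intro K f g : cont_mod1 K f -> (forall x, K x -> g x - f x \is a Num.int) ->
  (forall x, K x -> \forall y \near x, K y -> `|g y - g x| <= 1/2) -> is_lift K f g.
Proof.
move=> cf gi gn; split=> // x Kx e e0.
have d0 : 0 < Num.min e (1/2) by rewrite lt_min e0 /=; lra.
apply: filterS2 (gn x Kx) (cf x Kx _ d0) => y h1 h2 Ky.
apply: lt_le_trans (_ : Num.min e (1/2) <= e); last by rewrite ge_min lexx.
apply: near_int_small; [by rewrite ge_min lexx orbT|exact: h1|].
have -> : g y - g x = f y - f x + ((g y - f y) - (g x - f x)) by lra.
by apply: near_int_addint; [rewrite rpredB ?gi|exact: h2].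
Qed.

(** Integers closer than 1 agree, so [d] is locally constant on [K] and its level sets are
    relatively clopen. *)
Lemma int_valued_constant K (d : X -> R) : connected K -> cont_on K d ->
  (forall x, K x -> d x \is a Num.int) -> forall x y, K x -> K y -> d x = d y.
Proof.
move=> kK cd di x y Kx Ky.
have loc z : K z -> \forall t \near z, K t -> d t = d z.
  move=> Kz; have /(_ 1 ltr01) := cd z Kz; apply: filterS => t h Kt.
  by apply: int_close; [rewrite rpredB ?di|exact: h].
suff : [set t | K t /\ d t = d x] = K by move=> e; have [] : [set t | K t /\ d t = d x] y by rewrite e.
apply: kK; first by exists x.
  exists [set t | K t -> d t = d x]°; first exact: open_interior.
  rewrite eqEsubset; split=> t [Kt].
    by move=> e; split=> //; apply: filterS (loc t Kt) => u h /h; rewrite e.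
  by move=> /interior_subset h; split=> //; exact: h.
exists (~` [set t | K t -> d t <> d x]°); first by apply: open_closedC; exact: open_interior.
rewrite eqEsubset; split=> t [Kt].
  by move=> e; split=> // /interior_subset; apply.
move=> h; split=> //; apply: contrapT => ne; apply: h.
by apply: filterS (loc t Kt) => u h /h ->.
Qed.

Lemma lift_unique K f g h x : connected K -> is_lift K f g -> is_lift K f h ->
  K x -> g x = h x -> forall y, K y -> g y = h y.
Proof.
move=> kK [cg gi] [ch hi] Kx e y Ky; apply/eqP; rewrite -subr_eq0; apply/eqP.
rewrite -[RHS](subrr (g x)) {2}e.
apply: (@int_valued_constant K (fun z => g z - h z)) => //.
  have := cont_on_lin 1 (-1) cg ch; congr cont_on; apply/funext => z.
  by rewrite mul1r mulN1r.
move=> z Kz; have -> : g z - h z = (g z - f z) - (h z - f z) by lra.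
by rewrite rpredB ?gi ?hi.
Qed.

Lemma is_lift_shift K f g k : is_lift K f g -> k \is a Num.int -> is_lift K f (fun x => g x + k).
Proof.
move=> [cg gi] ki; split=> [x Kx e e0|x Kx]; last by rewrite addrAC rpredD ?gi.
by apply: filterS (cg x Kx e e0) => y; rewrite opprD addrACA subrr addr0.
Qed.

Lemma is_lift_at K f x t : liftable K f -> K x -> t - f x \is a Num.int ->
  exists2 g, is_lift K f g & g x = t.
Proof.
move=> [g lg] Kx ti; exists (fun y => g y + (t - g x)); last by rewrite addrC subrK.
apply: is_lift_shift => //; have -> : t - g x = (t - f x) - (g x - f x) by lra.
by apply: rpredB => //; case: lg => _; apply.
Qed.

Lemma cont_mod1N K f : cont_mod1 K f -> cont_mod1 K (fun x => - f x).
Proof.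
move=> h x Kx e e0; apply: filterS (h x Kx e e0) => y hy /hy /near_intN.
by rewrite opprB opprK addrC.
Qed.

Lemma is_liftN K f g : is_lift K f g -> is_lift K (fun x => - f x) (fun x => - g x).
Proof.
move=> [cg gi]; split=> [x Kx e e0|x Kx].
  by apply: filterS (cg x Kx e e0) => y; rewrite -opprD normrN.
by rewrite -opprD rpredN gi.
Qed.

Lemma liftableN K f : liftable K (fun x => - f x) -> liftable K f.
Proof.
move=> [g /is_liftN lg]; exists (fun x => - g x); move: lg; congr is_lift.
by apply/funext => x; rewrite opprK.
Qed.

(** * Lifting along chains and circular chains of small links *)

Section links.
Variables (K : set X) (n : nat) (U : 'I_n -> set X).
Hypothesis KU : forall x, K x -> exists i, U i x.
Hypothesis Uo : forall i x, K x -> U i x -> \forall y \near x, K y -> U i y.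

(** On each link, [f x] and [h x] have unique representatives [s], [s'] near [c i] and [c' i].
    Passing to another link moves them by [d] and [d'], which leaves [p * s + q * s'] unchanged;
    this value is the lift. *)
Lemma liftable_from_links f h (c c' : 'I_n -> R) (p q : R) :
  cont_mod1 K f -> cont_mod1 K h ->
  (forall i x, K x -> U i x -> near_int (1/8) (f x - c i)) ->
  (forall i x, K x -> U i x -> near_int (1/8) (h x - c' i)) ->
  p \is a Num.int -> q \is a Num.int ->
  (forall i j x, K x -> U i x -> U j x -> exists d d',
     [/\ d \is a Num.int, d' \is a Num.int, `|c j - c i - d| < 1/4,
        `|c' j - c' i - d'| < 1/4 & p * d + q * d' = 0]) ->
  liftable K (fun x => p * f x + q * h x).
Proof.
move=> cf ch fc hc pi qi ov.
pose rep x i s s' := [/\ U i x, s - f x \is a Num.int, s' - h x \is a Num.int,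
  `|s - c i| < 1/8 & `|s' - c' i| < 1/8].
have repex x i : K x -> U i x -> exists s s', rep x i s s'.
  move=> Kx Ux; have [s s1 s2] := near_int_rep (fc i x Kx Ux).
  by have [s' s1' s2'] := near_int_rep (hc i x Kx Ux); exists s, s'.
have /choice[g gP] : forall x, exists v, K x -> exists i s s', rep x i s s' /\ v = p * s + q * s'.
  move=> x; have [Kx|] := pselect (K x); last by exists 0.
  have [i Ux] := KU Kx; have [s [s' r]] := repex x i Kx Ux.
  by exists (p * s + q * s') => _; exists i, s, s'.
have gE x i s s' : K x -> rep x i s s' -> g x = p * s + q * s'.
  move=> Kx [Ux s1 s1' s2 s2'].
  have [j [t [t' [[Uj t1 t1' t2 t2'] ->]]]] := gP x Kx.
  have [d [d' [di di' dl dl' pq]]] := ov i j x Kx Ux Uj.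
  (* Since 1/8 + 1/8 + 1/4 is below 1, the integer [t - (s + d)] vanishes. *)
  have e1 : t = s + d.
    apply: int_close.
      have -> : t - (s + d) = (t - f x) - (s - f x) - d by lra.
      exact: rpredB (rpredB t1 s1) di.
    by move: t2 s2 dl; rewrite !ltr_norml => /andP[? ?] /andP[? ?] /andP[? ?]; lra.
  have e2 : t' = s' + d'.
    apply: int_close.
      have -> : t' - (s' + d') = (t' - h x) - (s' - h x) - d' by lra.
      exact: rpredB (rpredB t1' s1') di'.
    by move: t2' s2' dl'; rewrite !ltr_norml => /andP[? ?] /andP[? ?] /andP[? ?]; lra.
  by rewrite e1 e2 !mulrDr addrACA pq addr0.
exists g; split; last first.
  move=> x Kx; have [j [t [t' [[Uj t1 t1' t2 t2'] ->]]]] := gP x Kx.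
  by rewrite opprD addrACA -!mulrBr rpredD // rpredM.
move=> x Kx e e0; have [i Ux] := KU Kx; have [s [s' r]] := repex x i Kx Ux.
(* The bound 1/2 lets closeness modulo 1 be read as closeness; the summand 1 keeps the denominator
   positive even for [p = q = 0]. *)
pose m := Num.min (1/2) (e / (`|p| + `|q| + 1)).
have P0 : 0 < `|p| + `|q| + 1 by rewrite ltr_wpDl // addr_ge0.
have m0 : 0 < m by rewrite lt_min !divr_gt0.
have m2 : m <= 1/2 by rewrite ge_min lexx.
have me : m * (`|p| + `|q| + 1) <= e by rewrite -ler_pdivlMr // ge_min lexx orbT.
apply: filterS3 (Uo Kx Ux) (cf x Kx m m0) (ch x Kx m m0) => y h1 h2 h3 Ky.
have [t [t' r']] := repex y i Ky (h1 Ky).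
rewrite (gE _ _ _ _ Kx r) (gE _ _ _ _ Ky r').
have [_ a a' b b'] := r; have [_ a1 a1' b1 b1'] := r'.
have half (u v w : R) : `|u - w| < 1/8 -> `|v - w| < 1/8 -> `|v - u| <= 1/2.
  rewrite !ltr_norml => /andP[? ?] /andP[? ?].
  by rewrite ler_norml; apply/andP; split; lra.
have ts : `|t - s| < m.
  apply: near_int_small => //; first exact: half b b1.
  have -> : t - s = f y - f x + ((t - f y) - (s - f x)) by lra.
  by apply: near_int_addint; [exact: rpredB|exact: h2].
have ts' : `|t' - s'| < m.
  apply: near_int_small => //; first exact: half b' b1'.
  have -> : t' - s' = h y - h x + ((t' - h y) - (s' - h x)) by lra.
  by apply: near_int_addint; [exact: rpredB|exact: h3].
rewrite opprD addrACA -!mulrBr; apply: lt_le_trans me.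
apply: le_lt_trans (ler_normD _ _) _; rewrite !normrM.
by have := normr_ge0 p; have := normr_ge0 q; nra.
Qed.

(* Along the chain, f differs from a real-valued lift by the accumulated jumps;
   d and d' are the winding numbers of f and h when the links close up. *)
Lemma liftable_from_circular_links (W : Prop) f h :
  cont_mod1 K f -> cont_mod1 K h ->
  (forall i, exists2 x, K x & U i x) ->
  (forall i j : 'I_n, j = i.+1 :> nat -> exists x, [/\ K x, U i x & U j x]) ->
  (forall (i j : 'I_n) x, K x -> U i x -> U j x -> (`|i - j| <= 1)%N \/
     W /\ (i = 0%N :> nat /\ j = n.-1 :> nat \/ i = n.-1 :> nat /\ j = 0%N :> nat)) ->
  (forall i x y, K x -> K y -> U i x -> U i y -> near_int (1/8) (f x - f y)) ->
  (forall i x y, K x -> K y -> U i x -> U i y -> near_int (1/8) (h x - h y)) ->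
  exists d d', [/\ d \is a Num.int, d' \is a Num.int &
    forall p q, p \is a Num.int -> q \is a Num.int -> (W -> p * d + q * d' = 0) ->
      liftable K (fun x => p * f x + q * h x)].
Proof.
move=> cf ch U0 adj ov fU hU.
have base (F : X -> R) : (forall i x y, K x -> K y -> U i x -> U i y -> near_int (1/8) (F x - F y)) ->
    exists c : nat -> R,
      (forall (i : 'I_n) x, K x -> U i x -> near_int (1/8) (F x - c i)) /\
      (forall i, (i.+1 < n)%N -> `|c i.+1 - c i| < 1/4).
  move=> FU.
  have /choice[a aP] : forall i, exists r, forall l : (i < n)%N, exists x,
      [/\ K x, U (Ordinal l) x & r = F x].
    move=> i; have [l|l] := pselect (is_true (i < n)%N); last by exists 0 => l'; case: (l l').
    have [x Kx Ux] := U0 (Ordinal l); exists (F x) => l'; exists x; split=> //.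
    by rewrite (bool_irrelevance l' l).
  have /choice[k kP] : forall i, exists k, k \is a Num.int /\
      ((i.+1 < n)%N -> `|a i.+1 - a i - k| < 1/4).
    move=> i; have [l|l] := pselect (is_true (i.+1 < n)%N); last by exists 0; split=> //; rewrite rpred0.
    have [x [Kx Ux ->]] := aP _ l; have [y [Ky Uy ->]] := aP _ (ltnW l).
    have [|z [Kz Uz Uz']] := adj (Ordinal (ltnW l)) (Ordinal l); first by [].
    have := near_intD (FU _ x z Kx Kz Ux Uz') (FU _ z y Kz Ky Uz Uy).
    by rewrite addrA subrK => -[k' k'i k'l]; exists k'; split=> // _; lra.
  (* [a i] is a sample value of [F] on link [i] and [k i] the integer close to the jump to the next
     sample; subtracting the accumulated jumps makes consecutive centres close as reals. *)
  exists (fun i => a i - \sum_(j < i) k j); split.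
    move=> i x Kx Ux; have [y [Ky Uy e]] := aP _ (ltn_ord i).
    rewrite opprB addrCA addrC e; apply: near_int_addint.
      by apply: rpred_sum => j _; case: (kP j).
    apply: FU Kx Ky Ux _; move: Uy; congr (U _ _); exact: val_inj.
  move=> i l; rewrite big_ord_recr /=; have [_ /(_ l)] := kP i.
  by congr (`|_| < _); lra.
have [c [cP cS]] := base f fU; have [c' [cP' cS']] := base h hU.
have [[x0 Kx0]|K0] := pselect (K !=set0); last first.
  exists 0, 0; split; rewrite ?rpred0 // => p q _ _ _; exists (fun=> 0).
  by split=> x Kx; exfalso; apply: K0; exists x.
have n0 : (0 < n)%N by have [i _] := KU Kx0; exact: leq_ltn_trans (ltn_ord i).
have nn : (n.-1 < n)%N by rewrite prednK.
pose ends := exists x, [/\ K x, U (Ordinal n0) x & U (Ordinal nn) x].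
have wind (F : X -> R) (b : nat -> R) : (forall (i : 'I_n) x, K x -> U i x -> near_int (1/8) (F x - b i)) ->
    exists d, d \is a Num.int /\ (ends -> `|b n.-1 - b 0%N - d| < 1/4).
  move=> bP; have [[x [Kx Ux Ux']]|] := pselect ends; last by exists 0; split=> //; rewrite rpred0.
  have := near_intD (near_intN (bP _ x Kx Ux')) (bP _ x Kx Ux).
  by rewrite opprB addrA subrK /= => -[d di dl]; exists d; split=> // _; lra.
have [d [di dl]] := wind f c cP; have [d' [di' dl']] := wind h c' cP'.
exists d, d'; split=> // p q pi qi pq.
apply: (@liftable_from_links f h (fun i => c i) (fun i => c' i)) => // i j x Kx Ui Uj.
have adj_small (b : nat -> R) : (forall i, (i.+1 < n)%N -> `|b i.+1 - b i| < 1/4) ->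
    (`|i - j| <= 1)%N -> `|b j - b i - 0| < 1/4.
  move=> bS ij; rewrite subr0; have [e|e|e] := ltngtP (i : nat) j.
  - have e' : nat_of_ord j = i.+1 by lia.
    by rewrite e'; apply: bS; rewrite -e'.
  - have e' : nat_of_ord i = j.+1 by lia.
    by rewrite e' distrC; apply: bS; rewrite -e'.
  - by rewrite e subrr normr0; lra.
(* Neighbouring links contribute no jump. Between the two end links the jump is [(d, d')], up to
   sign by their order, and only then is [p * d + q * d' = 0] called upon. *)
case: (ov i j x Kx Ui Uj) => [ij|[w [] [ei ej]]].
- exists 0, 0; split; rewrite ?rpred0 ?mulr0 ?addr0 //; exact: adj_small.
- have en : ends.
    by exists x; split=> //; [move: Ui|move: Uj]; congr (U _ _); exact: val_inj.
  by exists d, d'; rewrite ei ej; split; rewrite ?dl ?dl' ?pq.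
- have en : ends.
    by exists x; split=> //; [move: Uj|move: Ui]; congr (U _ _); exact: val_inj.
  exists (- d), (- d'); rewrite ei ej !rpredN; split=> //.
  + by have := dl en; rewrite -normrN; congr (`|_| < _); lra.
  + by have := dl' en; rewrite -normrN; congr (`|_| < _); lra.
  + by rewrite !mulrN -opprD pq ?oppr0.
Qed.

End links.
End circle_maps.

(** Uniform continuity modulo 1; it decides how small the links of a chain must be. *)
Lemma cont_mod1_uniform (R : realType) (X : pseudoMetricType R) (K : set X) (f : X -> R) (d : R) :
  compact K -> cont_mod1 K f -> 0 < d ->
  exists2 e, 0 < e & forall x y, K x -> K y -> ball x e y -> near_int d (f x - f y).
Proof.
move=> /compact_near_coveringP cK cf d0; have d2 : 0 < d / 2 by rewrite divr_gt0.
have := cK R (0^'+) (fun e x => K x -> forall y, K y -> ball x e y -> near_int d (f x - f y)) _.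
move=> /(_ _)[|].
- move=> x Kx; have /nbhs_ballP[r /= r0 hr] := cf x Kx _ d2.
  exists (ball x (r / 2), [set e | 0 < e < r / 2]) => /=.
    split; first by apply: nbhsx_ballx; rewrite divr_gt0.
    by near=> e; apply/andP; split; near: e; [exact: nbhs_right_gt|
      apply: nbhs_right_lt; rewrite divr_gt0].
  move=> [y e] /= [xy /andP[e0 er]] Ky z Kz yz.
  have hy := hr y (le_ball _ xy) Ky.
  have hz : near_int (d / 2) (f z - f x).
    apply: hr Kz; rewrite [r]splitr; apply: ball_triangle xy (le_ball _ yz); exact: ltW.
  have := near_intD (hy _) (near_intN hz); rewrite -splitr opprB addrA subrK; apply.
  by rewrite ler_pdivrMr // ler_peMr // ?ler1n // ltW.
- move=> r /= r0 hr; exists (r / 2); first by rewrite divr_gt0.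
  move=> x y Kx Ky; apply: (hr (r / 2)) => //=.
    by rewrite /ball_ sub0r normrN gtr0_norm ?divr_gt0 // ltr_pdivrMr // ltr_pMr // ltr1n.
  by rewrite divr_gt0.
Unshelve. all: by end_near.
Qed.

(** * The infinite cyclic cover *)

Lemma hausdorff_prod (S T : topologicalType) :
  hausdorff_space S -> hausdorff_space T -> hausdorff_space (S * T)%type.
Proof.
move=> hS hT [p1 p2] [q1 q2] cl; congr (_, _).
  apply: hS => A B pA qB.
  have [||[x y] [[/= Ax _] [/= Bx _]]] := cl (A `*` setT) (B `*` setT).
  - by exists (A, setT) => //; split=> //; exact: filterT.
  - by exists (B, setT) => //; split=> //; exact: filterT.
  by exists x.
apply: hT => A B pA qB.
have [||[x y] [[/= _ Ay] [/= _ By]]] := cl (setT `*` A) (setT `*` B).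
- by exists (setT, A) => //; split=> //; exact: filterT.
- by exists (setT, B) => //; split=> //; exact: filterT.
by exists y.
Qed.

Lemma near_int_all (R : realType) (r : R) : (forall e, 0 < e -> near_int e r) -> r \is a Num.int.
Proof.
move=> h; have [|k ki kl] := h (1/4); first by lra.
suff -> : r = k by [].
apply/eqP; rewrite -subr_eq0 -normr_eq0 eq_le normr_ge0 andbT.
apply/ler_addgt0Pr => e e0; rewrite add0r.
have [|l li ll] := h (Num.min e (1/4)); first by rewrite lt_min e0; lra.
have <- : l = k.
  apply: int_close; first exact: rpredB.
  have : `|r - l| < 1/4 by rewrite (lt_le_trans ll) // ge_min lexx orbT.
  by move: kl; rewrite !ltr_norml => /andP[? ?] /andP[? ?]; lra.
by apply: ltW; rewrite (lt_le_trans ll) // ge_min lexx.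
Qed.

Section cover.
Context {R : realType} {X : pseudoMetricType R}.
Hypothesis hX : hausdorff_space X.
Hypothesis cX : compact [set: X].
Implicit Types f g : X -> R.

Let hXR : hausdorff_space (X * R)%type.
Proof. by apply: hausdorff_prod => //; exact: Rhausdorff. Qed.

(** The pullback along [f] of the covering of the circle by the line; lifts of [f] are its
    continuous sections. *)
Definition cyclic_cover f : set (X * R) := [set z | z.2 - f z.1 \is a Num.int].

Lemma cover_closed f : cont_mod1 setT f -> closed (cyclic_cover f).
Proof.
move=> cf [x t] clz; apply: near_int_all => e e0 /=.
have e2 : 0 < e / 2 by rewrite divr_gt0.
have [|[y s] [/= ys [/= hy hs]]] :=
    clz ([set y | near_int (e / 2) (f y - f x)] `*` [set s | `|t - s| < e / 2]).
  exists ([set y | near_int (e / 2) (f y - f x)], [set s | `|t - s| < e / 2]) => //=.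
  split=> /=; first by apply: filterS (cf x I _ e2) => y; apply.
  by apply/nbhs_ballP; exists (e / 2).
have -> : t - f x = (f y - f x) + (t - s) + (s - f y) by lra.
apply: near_int_addint => //; rewrite [e]splitr; apply: near_intD hy _.
by exists 0; rewrite ?rpred0 ?subr0.
Qed.

(** The tube lemma over a compact segment: it turns closedness of a set in the cover into local
    bounds on heights. *)
Lemma tube (C : set (X * R)) x (a b : R) : closed C ->
  (forall s, a <= s <= b -> ~ C (x, s)) ->
  \forall y \near x, forall s, a <= s <= b -> ~ C (y, s).
Proof.
move=> clC hC.
have /compact_near_coveringP cov := @segment_compact R a b.
have : \forall y \near x, `[a, b]%classic `<=` (fun s => ~ C (y, s)).
  apply: cov => s; rewrite /= in_itv /= => sab.
  have : nbhs (x, s) (~` C).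
    by apply: open_nbhs_nbhs; split; [exact: closed_openC|exact: hC].
  move=> [[A B] [/= nA nB] AB]; exists (B, A) => // -[s' y'] [/= Bs Ay].
  exact: (AB (y', s')).
by apply: filterS => y h s sab; apply: h; rewrite /= in_itv.
Qed.

Lemma proj_cpt_conn (A : set (X * R)) : cpt_conn A -> cpt_conn (fst @` A).
Proof.
move=> [cA kA]; have c : continuous (@fst X R) by move=> z; exact: cvg_fst.
split; first by apply: continuous_compact => //; exact: continuous_subspaceT.
by apply: connected_continuous_connected => //; exact: continuous_subspaceT.
Qed.

Lemma graph_cpt_conn (K : set X) g : cpt_conn K -> cont_on K g ->
  cpt_conn [set (x, g x) | x in K].
Proof.
move=> [cK kK] /cont_onP cg.
have c : {within K, continuous (fun x => (x, g x))}.
  apply/subspace_continuousP => x Kx; apply: (@cvg_pair _ _ _ _ (nbhs x) (nbhs (g x))); first exact: cvg_within.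
  by move/subspace_continuousP : cg; apply.
by split; [exact: continuous_compact|exact: connected_continuous_connected].
Qed.

Lemma lift_nbr f x t : cont_mod1 setT f -> t - f x \is a Num.int ->
  forall e, 0 < e -> \forall y \near x, exists2 s, s - f y \is a Num.int & `|s - t| < e.
Proof.
move=> cf ti e e0; apply: filterS (cf x I e e0) => y /(_ I) h.
apply: near_int_rep; have -> : f y - t = f y - f x - (t - f x) by lra.
by apply: near_int_addint; rewrite ?rpredN.
Qed.

(** The lift picks the highest point of [E] in each fibre. It cannot jump up because [E] is closed
    and bounded above, nor drop because the rest of the cover is closed. *)
Lemma clopen_section f (E : set (X * R)) (M : R) : cont_mod1 setT f ->
  closed E -> closed (cyclic_cover f `\` E) -> E `<=` cyclic_cover f ->
  (forall z, E z -> z.2 <= M) -> (forall x, exists t, E (x, t)) -> liftable setT f.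
Proof.
move=> cf clE clE' Ef EM Ex.
have /choice[g gP] : forall x, exists t, E (x, t) /\ forall s, E (x, s) -> s <= t.
  move=> x; have [t0 Et0] := Ex x; pose T := [set t | E (x, t)].
  have sT : has_sup T by split; [exists t0|exists M => t /EM].
  (* Heights in one fibre differ by integers, so an element within 1 of the supremum is the
     maximum. *)
  have [t Et lt] := sup_adherent ltr01 sT; exists t; split=> // s Es.
  have ss : s <= sup T by apply: ub_le_sup => //; case: sT.
  have /intrP[k e] : s - t \is a Num.int.
    have -> : s - t = s - f x - (t - f x) by lra.
    exact: rpredB (Ef _ Es) (Ef _ Et).
  have : s - t < 1 by lra.
  rewrite e -[1]/(1%:~R) ltr_int => k1; rewrite -subr_le0 e -[0]/(0%:~R) ler_int.
  by lia.
exists g; apply: lift_intro => // [x _|x _]; first by have [/Ef] := gP x.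
have [Egx gx] := gP x.
have up := @tube E x (g x + 1/2) M clE.
have dn := @tube (cyclic_cover f `\` E) x (g x - 1/2) (g x + 1/2) clE'.
have h2 : 0 < 1/2 :> R by lra.
apply: filterS3 (up _) (dn _) (lift_nbr cf (Ef _ Egx) h2) => [y uy dy [s si sl] _||].
- have [Egy gy] := gP y; move: sl; rewrite ltr_norml /= => /andP[s1 s2].
  have Es : E (y, s).
    by apply: contrapT => nE; apply: (dy s); [by apply/andP; split; lra|split].
  have sg := gy _ Es; rewrite ler_norml; apply/andP; split; first by lra.
  rewrite leNgt; apply/negP => l; apply: (uy (g y)) => //.
  by rewrite (EM _ Egy) andbT; lra.
- by move=> s /andP[s1 _] /gx; lra.
- move=> s /andP[s1 s2] [/= si]; apply; suff -> : s = g x by [].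
  apply: int_close; last by rewrite ltr_norml; apply/andP; split; lra.
  have -> : s - g x = s - f x - (g x - f x) by lra.
  exact: rpredB si (Ef _ Egx).
Qed.

Lemma closed_below b : closed [set z : X * R | z.2 <= b].
Proof.
have -> : [set z : X * R | z.2 <= b] = snd @^-1` [set t | t <= b] by [].
by apply: preimage_closed; [move=> z _; exact: cvg_snd|exact: closed_le].
Qed.

Lemma closed_above a : closed [set z : X * R | a <= z.2].
Proof.
have -> : [set z : X * R | a <= z.2] = snd @^-1` [set t | a <= t] by [].
by apply: preimage_closed; [move=> z _; exact: cvg_snd|exact: closed_ge].
Qed.

Lemma compact_strip (C : set (X * R)) a b : closed C ->
  (forall z, C z -> a <= z.2 <= b) -> compact C.
Proof.
move=> clC h; apply: (subclosed_compact clC (compact_setX cX (@segment_compact R a b))).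
by move=> z /h zab; split=> //=; rewrite in_itv.
Qed.

Lemma compact_heights (C : set (X * R)) : compact C ->
  exists M, forall z, C z -> `|z.2| <= M.
Proof.
move=> cC; apply: (cont_on_bounded cC); apply/cont_onP.
by apply: continuous_subspaceT => z; exact: cvg_snd.
Qed.

(** For integral [k], a deck transformation of the cover. *)
Definition shift (k : R) (z : X * R) := (z.1, z.2 + k).

Lemma shift_continuous k : continuous (shift k).
Proof.
move=> z; apply: (@cvg_pair _ _ _ _ (nbhs z.1) (nbhs (z.2 + k))); first exact: cvg_fst.
by apply: cvgD; [exact: cvg_snd|exact: cvg_cst].
Qed.

Lemma shift_cpt_conn k A : cpt_conn A -> cpt_conn (shift k @` A).
Proof.
move=> [cA kA]; have c := @continuous_subspaceT _ _ A _ (@shift_continuous k).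
by split; [exact: continuous_compact|exact: connected_continuous_connected].
Qed.

Lemma shiftK k : cancel (shift k) (shift (- k)).
Proof. by move=> [x t]; rewrite /shift /= addrK. Qed.

Lemma shiftVK k : cancel (shift (- k)) (shift k).
Proof. by move=> [x t]; rewrite /shift /= subrK. Qed.

Lemma shift_cover f k z : k \is a Num.int -> cyclic_cover f z -> cyclic_cover f (shift k z).
Proof. by move=> ki zi; rewrite /cyclic_cover /= addrAC rpredD. Qed.

Lemma proj_shift k A : fst @` (shift k @` A) = fst @` A.
Proof.
rewrite eqEsubset; split=> [_ [_ [z Az <-] <-]|_ [z Az <-]]; first by exists z.
by exists (shift k z) => //; exists z.
Qed.

(** Iterating the inclusion puts every [shift (- (k *+ n)) z] into [A], against the boundedness of
    heights on a compact set. *)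
Lemma compact_not_sub_shift (A : set (X * R)) k : compact A -> A !=set0 -> k != 0 ->
  ~ A `<=` shift k @` A.
Proof.
move=> cA [z Az] k0 h; have [M hM] := compact_heights cA.
have it n : A (shift (- (k *+ n)) z).
  elim: n => [|n IH]; first by case: z Az => x t; rewrite /shift mulr0n subr0.
  have [w Aw e] := h _ IH; suff -> : shift (- (k *+ n.+1)) z = w by [].
  rewrite -[w](shiftK k) e /shift /=; congr (_, _).
  by rewrite mulrS opprD -addrA [- k + _]addrC.
have hn n : `|k| *+ n <= M + `|z.2|.
  rewrite -normrMn; have := hM _ (it n); rewrite /shift /=.
  by have := ler_normB z.2 (z.2 - k *+ n); rewrite subKr; lra.
have k1 : 0 < `|k| by rewrite normr_gt0.
have := hn (Num.bound ((M + `|z.2|) / `|k|)).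
rewrite -mulr_natl -ler_pdivlMr // leNgt => /negP; apply.
apply: archi_boundP; rewrite divr_ge0 // addr_ge0 //.
exact: le_trans (hM _ Az).
Qed.

(** Unique lifting: the difference of [g u.1] and the height [u.2] is continuous and integer-valued
    on [A], and vanishes at [z]. *)
Lemma continuum_on_lift f (K : set X) g (A : set (X * R)) z : cpt_conn A -> A `<=` cyclic_cover f ->
  is_lift K f g -> fst @` A `<=` K -> A z -> g z.1 = z.2 -> forall w, A w -> g w.1 = w.2.
Proof.
move=> [cA kA] Af [cg gi] AK Az e w Aw; apply/eqP; rewrite -subr_eq0; apply/eqP.
rewrite -[RHS](subrr (g z.1)) {2}e.
apply: (@int_valued_constant _ _ A (fun z => g z.1 - z.2)) => // [|u Au]; last first.
  have -> : g u.1 - u.2 = g u.1 - f u.1 - (u.2 - f u.1) by lra.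
  exact: rpredB (gi u.1 (AK _ (imageP _ Au))) (Af _ Au).
move=> u Au r r0; have r2 : 0 < r / 2 by rewrite divr_gt0.
have Ku : K u.1 by apply: AK; exists u.
have h1 : \forall v \near u, K v.1 -> `|g v.1 - g u.1| < r / 2.
  by have := cg _ Ku _ r2; exact: (@cvg_fst _ _ (nbhs u.1) (nbhs u.2)).
have h2 : \forall v \near u, `|u.2 - v.2| < r / 2.
  have : \forall s \near u.2, `|u.2 - s| < r / 2 by apply/nbhs_ballP; exists (r / 2).
  exact: (@cvg_snd _ _ (nbhs u.1) (nbhs u.2)).
apply: filterS2 h1 h2 => v h1 h2 Av.
have -> : g v.1 - v.2 - (g u.1 - u.2) = (g v.1 - g u.1) + (u.2 - v.2) by lra.
rewrite [r]splitr (le_lt_trans (ler_normD _ _)) // ltrD // h1 //.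
by apply: AK; exists v.
Qed.

End cover.

(** * Ends of the cover and types of points *)

Section composants.
Context {R : realType} {X : pseudoMetricType R}.
Hypothesis hX : hausdorff_space X.
Hypothesis cX : compact [set: X].
Hypothesis kX : connected [set: X].
(** Hereditary indecomposability enters through [nested], and chainability of the proper subcontinua
    through [proper_liftable]. *)
Hypothesis nested : forall A B : set X, cpt_conn A -> cpt_conn B ->
  A `&` B !=set0 -> A `<=` B \/ B `<=` A.
Hypothesis proper_liftable : forall (f : X -> R) K, cont_mod1 setT f ->
  cpt_conn K -> K <> setT -> liftable K f.
Implicit Types f g : X -> R.

Let hXR : hausdorff_space (X * R)%type.
Proof. by apply: hausdorff_prod => //; exact: Rhausdorff. Qed.

Section essential.
Variable f : X -> R.
Hypothesis cf : cont_mod1 setT f.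
Hypothesis nf : ~ liftable setT f.

(** The projections are nested, and over the larger one [f] lifts; both continua lie on the graph of
    its lift through [z], so they are nested as their projections are. *)
Lemma nested_proper_lifts (A B : set (X * R)) z : cpt_conn A -> cpt_conn B ->
  A `<=` cyclic_cover f -> B `<=` cyclic_cover f -> A z -> B z ->
  fst @` A <> setT -> fst @` B <> setT -> A `<=` B \/ B `<=` A.
Proof.
have key (C D : set (X * R)) : cpt_conn C -> cpt_conn D -> C `<=` cyclic_cover f -> D `<=` cyclic_cover f ->
    C z -> D z -> fst @` D <> setT -> fst @` C `<=` fst @` D -> C `<=` D.
  move=> cC cD Cf Df Cz Dz pD CD.
  have lD := proper_liftable cf (proj_cpt_conn cD) pD.
  have [|g lg gz] := is_lift_at lD (imageP _ Dz) (_ : z.2 - f z.1 \is a Num.int).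
    exact: Df.
  move=> w Cw; have [u Du uw] := CD _ (imageP _ Cw).
  have e1 := continuum_on_lift cC Cf lg CD Cz gz Cw.
  have e2 := continuum_on_lift cD Df lg (fun _ h => h) Dz gz Du.
  suff -> : w = u by [].
  by case: w u uw e1 e2 {Cw Du} => [w1 w2] [u1 u2] /= -> <- <-.
move=> cA cB Af Bf Az Bz pA pB.
have := nested (proj_cpt_conn cA) (proj_cpt_conn cB) _.
case=> [|AB|BA]; first by exists z.1; split; exists z.
- by left; exact: key.
- by right; exact: key.
Qed.

(* A continuum in the cover that projects onto X, chosen minimal, would be
   disjoint from its translates: at a common point its proper subcontinua and
   those of the translate are nested. So it would be the graph of a lift. *)
Lemma continuum_in_cover_not_onto (A : set (X * R)) : cpt_conn A -> A `<=` cyclic_cover f ->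
  fst @` A <> setT.
Proof.
move=> cA Af pA.
pose P := [set B : set (X * R) | B `<=` cyclic_cover f /\ fst @` B = setT].
have [||Q [cQ [Qf pQ] mQ]] := @minimal_continuum _ _ hXR P A cA; first by [].

  move=> F [B0 FB0] FP tF; split.
    by move=> z h; have [_ [Bf _]] := FP _ FB0; apply: Bf; exact: h.
  rewrite eqEsubset; split=> // x _.
  have [cB0 [B0f pB0]] := FP _ FB0.
  (* The fibre of [B0] over [x] is compact and meets every member of the chain, so the intersection
     still projects onto [X]. *)
  have [|||||z Wz h] := @directed_compact_meet _ (B0 `&` fst @^-1` [set x]) F.
  - apply: compact_closedI; first by case: cB0.
    apply: preimage_closed; first by move=> z _; exact: cvg_fst.
    by apply: (compact_closed hX); exact: compact_set1.
  - by exists B0.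
  - by move=> B /FP[[cB _] _]; exact: compact_closed.
  - move=> B C FB FC; case: (tF B C FB FC) => s; [exists B|exists C] => // u Bu; split=> //; exact: s.
  - move=> B FB; have [_ [_ pB]] := FP _ FB; case: (tF B B0 FB FB0) => s.
      have [u Bu ux] : (fst @` B) x by rewrite pB.
      by exists u; split=> //; split=> //; exact: s.
    have [u Bu ux] : (fst @` B0) x by rewrite pB0.
    by exists u; split=> //; exact: s.
  by exists z; [exact: h|case: Wz].
have mQ' B : cpt_conn B -> B `<=` Q -> B <> Q -> fst @` B <> setT.
  move=> cB BQ nBQ pB; apply: nBQ; apply: mQ => //; split=> //.
  exact: subset_trans Qf.
have [x0 Qx0] : Q !=set0.
  apply: contrapT => Q0; apply: nf; exists (fun=> 0); split=> x _.
    exfalso; have [z Qz _] : (fst @` Q) x by rewrite pQ.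
    by apply: Q0; exists z.
  exfalso; have [z Qz _] : (fst @` Q) x by rewrite pQ.
  by apply: Q0; exists z.
have disj k z : k \is a Num.int -> k != 0 -> Q z -> (shift k @` Q) z -> False.
  move=> ki k0 Qz Qkz.
  have ck := shift_cpt_conn k cQ.
  have shiftN : shift (- k) @` (shift k @` Q) = Q.
    rewrite eqEsubset; split=> [_ [_ [u Qu <-] <-]|u Qu]; first by rewrite shiftK.
    by exists (shift k u); [exists u|rewrite shiftK].
  (* By minimality, proper subcontinua of [Q] and of its translate have proper projections, hence
     are nested at [z]. Then [Q] and the translate are nested too, which compactness forbids in
     either direction. *)
  have [] := @nested_from_proper _ _ hXR Q (shift k @` Q) z cQ ck Qz Qkz.
  - move=> B C cB cC BQ CQ Bz Cz nB nC.
    apply: (@nested_proper_lifts B C z) => //.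
    + exact: subset_trans Qf.
    + by move=> w /CQ[u Qu <-]; apply: shift_cover => //; exact: Qf.
    + exact: mQ'.
    + rewrite -(proj_shift (- k)); apply: mQ'; first exact: shift_cpt_conn.
        by rewrite -[X in _ `<=` X]shiftN; exact: image_subset.
      move=> e; apply: nC; rewrite -e eqEsubset; split=> u.
        by move=> Cu; exists (shift (- k) u); [exists u|rewrite shiftVK].
      by move=> [_ [v Cv <-] <-]; rewrite shiftVK.
  - by apply: compact_not_sub_shift => //; [case: cQ|exists z].
  - move=> s; apply: (@compact_not_sub_shift _ _ Q (- k)).
    + by case: cQ.
    + by exists z.
    + by rewrite oppr_eq0.
    + by rewrite -{1}shiftN; exact: image_subset.
have Qu u v : Q u -> Q v -> u.1 = v.1 -> u = v.
  move=> Qu Qv e; have [d0|dn] := eqVneq (u.2 - v.2) 0.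
    by case: u v e d0 {Qu Qv} => [? ?] [? ?] /= -> /eqP; rewrite subr_eq0 => /eqP ->.
  exfalso; apply: (disj (u.2 - v.2) u) => //.
    have -> : u.2 - v.2 = (u.2 - f u.1) - (v.2 - f v.1) by rewrite e; lra.
    by apply: rpredB; exact: Qf.
  exists v => //; rewrite /shift addrCA subrr addr0 -e.
  by case: (u).
have clQ : closed Q by apply: compact_closed => //; case: cQ.
have [M hM] := compact_heights cQ.1.
have /choice[g gP] : forall x, exists t, Q (x, t).
  move=> x; have [[y t] Qz /= <-] : (fst @` Q) x by rewrite pQ.
  by exists t.
apply: nf; exists g; apply: lift_intro => // [x _|x _]; first exact: Qf (gP x).
have up := @tube _ _ Q x (g x + 1/2) M clQ.
have dn := @tube _ _ Q x (- M) (g x - 1/2) clQ.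
apply: filterS2 (up _) (dn _) => [y uy dy _||].
- have := hM _ (gP y); rewrite ler_norml /= => /andP[m1 m2].
  rewrite ler_norml; apply/andP; split; rewrite leNgt; apply/negP => l.
    by apply: (dy (g y) _ (gP y)); apply/andP; split; lra.
  by apply: (uy (g y) _ (gP y)); apply/andP; split; lra.
- by move=> s /andP[s1 _] Qs; have [] := Qu _ _ (gP x) Qs erefl; lra.
- by move=> s /andP[_ s1] Qs; have [] := Qu _ _ (gP x) Qs erefl; lra.
Qed.

(* The points of the cover that, below height b, cannot be cut off from the
   bottom end. *)
Definition lower_end b : set (X * R) := [set z | [/\ cyclic_cover f z, z.2 <= b &
  forall E, closed E -> closed (cyclic_cover f `&` [set z | z.2 <= b] `\` E) ->
    E `<=` cyclic_cover f `&` [set z | z.2 <= b] -> (exists a, forall w, E w -> a < w.2) ->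
    ~ E z]].

Lemma lower_end_closed b : closed (lower_end b).
Proof.
pose F E := [/\ closed E, closed (cyclic_cover f `&` [set z | z.2 <= b] `\` E),
    E `<=` cyclic_cover f `&` [set z | z.2 <= b] & exists a, forall w : X * R, E w -> a < w.2].
have -> : lower_end b = \bigcap_(E in F) (cyclic_cover f `&` [set z | z.2 <= b] `\` E).
  rewrite eqEsubset; split=> [z [zf zb h] E [E1 E2 E3 E4]|z h].
    by split=> //; exact: h.
  have [] : (cyclic_cover f `&` [set z | z.2 <= b] `\` set0) z.
    apply: h; split=> //; first exact: closed0.
    - rewrite setD0; apply: closedI; [exact: cover_closed|exact: closed_below].
    - by exists 0.
  move=> [zf zb] _; split=> // E E1 E2 E3 E4.
  by have [] : (cyclic_cover f `&` [set z | z.2 <= b] `\` E) z by apply: h.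
by apply: closed_bigI => E [].
Qed.

(** If every point at height [b] could be cut off, compactness of that slice would give one
    bounded-below clopen [E] containing all of it. The rest of the cover below [b] would then be
    clopen in the whole cover, bounded above, and would meet every fibre far below, so
    [clopen_section] would lift [f]. *)
Lemma lower_end_nonempty b : lower_end b !=set0.
Proof.
have clf := cover_closed cf.
pose S : set (X * R) := cyclic_cover f `&` [set z | b <= z.2 <= b].
have clS : closed S.
  apply: closedI => //.
  have -> : [set z : X * R | b <= z.2 <= b] = [set z | b <= z.2] `&` [set z | z.2 <= b].
    by rewrite eqEsubset; split=> z /= => [/andP|] [-> ->].
  by apply: closedI; [exact: closed_above|exact: closed_below].
have cS : compact S by apply: (compact_strip (a := b) (b := b) cX clS) => z [_].
pose adm E := [/\ closed E, closed (cyclic_cover f `&` [set z | z.2 <= b] `\` E),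
    E `<=` cyclic_cover f `&` [set z | z.2 <= b] & exists a, forall w : X * R, E w -> a < w.2].
pose F := [set cyclic_cover f `&` [set z | z.2 <= b] `\` E | E in adm].
have [||||z Sz h] := @directed_compact_meet _ S F cS.
- exists (cyclic_cover f `&` [set z | z.2 <= b] `\` set0); exists set0 => //; split=> //.
  + exact: closed0.
  + by rewrite setD0; apply: closedI => //; exact: closed_below.
  + by exists 0.
- by move=> _ [E [_ ? _ _] <-].
- move=> _ _ [E [E1 E2 E3 [a Ea]] <-] [E' [E1' E2' E3' [a' Ea']] <-].
  exists (cyclic_cover f `&` [set z | z.2 <= b] `\` (E `|` E')); last by rewrite setDUr.
  exists (E `|` E') => //; split; first exact: closedU.
  + by rewrite setDUr; exact: closedI.
  + by move=> z [/E3|/E3'].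
  + by exists (Num.min a a') => w [/Ea|/Ea'] l; rewrite gt_min l ?orbT.
- move=> _ [E [E1 E2 E3 [a Ea]] <-]; apply: contrapT => hS.
  have SE z : S z -> E z.
    move=> [zf /andP[z1 z2]]; apply: contrapT => nE; apply: hS.
    by exists z; split=> //; split=> //; apply/andP.
  apply: nf; apply: (clopen_section (E := cyclic_cover f `&` [set z | z.2 <= b] `\` E) (M := b)) => //.
  + have -> : cyclic_cover f `\` (cyclic_cover f `&` [set z | z.2 <= b] `\` E) =
        (cyclic_cover f `&` [set z | b <= z.2]) `|` E.
      rewrite eqEsubset; split=> z.
        move=> [zf h]; have [Ez|nE] := pselect (E z); [by right|left; split=> //=].
        by rewrite leNgt; apply/negP => l; apply: h; do 2 split => //; exact: ltW.
      move=> [[zf bz]|Ez]; last by split; [have [] := E3 _ Ez|move=> []].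
      split=> // -[[_ zb] nE]; apply: nE; apply: SE; split=> //=.
      by rewrite bz.
    by apply: closedU => //; apply: closedI => //; exact: closed_above.
  + by move=> z [[]].
  + by move=> z [[]].
  (* [t] is the highest point of the fibre at or below [m]; as [E] lies above [a], it misses this
     point. *)
  + move=> x; pose m := Num.min a b.
    pose t := f x + (Num.floor (m - f x))%:~R.
    have tm : t <= m by rewrite /t -lerBrDl ge_floor.
    exists t; split; [split=> /=|].
    * by rewrite /cyclic_cover /t /= addrAC subrr add0r.
    * by rewrite (le_trans tm) // ge_min lexx orbT.
    * move=> /Ea /=; apply/negP; rewrite -leNgt (le_trans tm) // ge_min lexx //.
exists z; case: Sz => zf /andP[_ zb]; split=> // E E1 E2 E3 E4 Ez.
by have /(_ (cyclic_cover f `&` [set z | z.2 <= b] `\` E))[|] := h; first by exists E.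
Qed.

(** The quasi-component of [z] in the strip between [m] and [b] must reach height [m]: a clopen part
    of the strip staying above [m] would be clopen below [b] and bounded below, against [lower_end].
    As it does not project onto [X], it is the graph of a lift. *)
Lemma lower_end_continuum b z m : lower_end b z -> exists K g y,
  [/\ cpt_conn K, K z.1, is_lift K f g & g z.1 = z.2] /\
  [/\ forall u, K u -> g u <= b, K y & g y <= m].
Proof.
move=> [zf zb hz]; have clf := cover_closed cf.
have [mz|zm] := leP z.2 m.
  exists [set z.1], (fun=> z.2), z.1; split; split=> //.
  - exact: cpt_conn1.
  - split=> [x _ e e0|x ->]; last exact: zf.
    by apply: nearW => y _; rewrite subrr normr0.
pose W : set (X * R) := cyclic_cover f `&` [set w | m <= w.2] `&` [set w | w.2 <= b].
have clW : closed W.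
  by apply: closedI; [apply: closedI => //; exact: closed_above|exact: closed_below].
have cW : compact W by apply: (compact_strip (a := m) (b := b) cX clW) => w [[_ /= -> /= ->]].
have [||||A [cA AW Az [w [Aw wm]]]] := @continuum_to_closed _ _ hXR W [set w | w.2 <= m] z.
- by [].
- by split=> //; split=> //=; exact: ltW.
- exact: closed_below.
- move=> E E1 E2 E3 Ez; apply: contrapT => hE.
  have Em w : E w -> m < w.2.
    by move=> Ew; rewrite ltNge; apply/negP => l; apply: hE; exists w.
  apply: (hz E) => //; last by exists m.
    have -> : cyclic_cover f `&` [set z | z.2 <= b] `\` E = (W `\` E) `|`
        (cyclic_cover f `&` [set w | w.2 <= m] `&` [set w | w.2 <= b]).
      rewrite eqEsubset; split=> w.
        move=> [[wf wb] nE]; have [l|/ltW l] := leP w.2 m; last by left.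
        by right; split.
      move=> [[[[wf _] wb] nE]|[[wf wm] wb]]; first by [].
      split=> // /Em; apply/negP; by rewrite -leNgt.
    apply: closedU => //; apply: closedI; last exact: closed_below.
    by apply: closedI => //; exact: closed_below.
  by move=> w /E3[[]].
have Af : A `<=` cyclic_cover f by move=> u /AW[[]].
have pA := continuum_in_cover_not_onto cA Af.
have lA := proper_liftable cf (proj_cpt_conn cA) pA.
have [|g lg gz] := is_lift_at lA (imageP _ Az) (_ : z.2 - f z.1 \is a Num.int) => //.
have gA := continuum_on_lift cA Af lg (fun _ h => h) Az gz.
exists (fst @` A), g, w.1; split; split=> //.
- exact: proj_cpt_conn.
- by exists z.
- by move=> _ [u Au <-]; rewrite gA //; case: (AW _ Au).
- by rewrite gA.
Qed.

End essential.

(** The difference [g y - g x] does not depend on the lift, as [K] is connected. Properness of [K]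
    need not be stated: when [f] is essential, the existence of [g] forces it. *)
Definition down f x := forall m : R, exists K g y,
  [/\ cpt_conn K, K x, is_lift K f g, K y & g y - g x <= m].

Definition up f x := forall m : R, exists K g y,
  [/\ cpt_conn K, K x, is_lift K f g, K y & m <= g y - g x].

(** Symmetric in the two directions, so that it survives maps that exchange them. *)
Definition one_way f x := (down f x /\ ~ up f x) \/ (up f x /\ ~ down f x).

Lemma downN f x : up (fun y => - f y) x <-> down f x.
Proof.
split=> h m; have [K [g [y [cK Kx lg Ky l]]]] := h (- m); exists K, (fun y => - g y), y.
  split=> //; last by lra.
  by have := is_liftN lg; congr is_lift; apply/funext => u; rewrite opprK.
by split=> //; [exact: is_liftN|lra].
Qed.

Lemma upN f x : down (fun y => - f y) x <-> up f x.
Proof.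
by rewrite -downN; have -> : (fun y => - - f y) = f by apply/funext => u; rewrite opprK.
Qed.

Lemma lower_end_down f b z : cont_mod1 setT f -> ~ liftable setT f ->
  lower_end f b z -> down f z.1.
Proof.
move=> cf nf hz m; have [K [g [y [[cK Kz lg gz] [_ Ky l]]]]] := lower_end_continuum cf nf (m + z.2) hz.
by exists K, g, y; split=> //; rewrite gz; lra.
Qed.

Lemma nested_lifts f K L g h x : cpt_conn K -> cpt_conn L -> K x -> L x ->
  is_lift K f g -> is_lift L f h -> g x = h x ->
  (K `<=` L /\ forall y, K y -> g y = h y) \/ (L `<=` K /\ forall y, L y -> g y = h y).
Proof.
move=> cK cL Kx Lx lg lh e; case: (nested cK cL); first by exists x.
  move=> KL; left; split=> // y Ky.
  exact: (lift_unique cK.2 lg (is_liftS KL lh) Kx e).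
move=> LK; right; split=> // y Ly.
exact: (lift_unique cL.2 (is_liftS LK lg) lh Lx e).
Qed.

(** Compare a continuum [K] rising to height [b + 1] with an [L] that stays below [b] and descends
    beneath everything over [K]. They are nested: [K] inside [L] violates the ceiling [b], and [L]
    inside [K] violates the bound on the lift over [K]. *)
Lemma lower_end_not_up f b z : cont_mod1 setT f -> ~ liftable setT f ->
  lower_end f b z -> ~ up f z.1.
Proof.
move=> cf nf hz hup; have [K [g [y [cK Kz lg Ky l]]]] := hup (b + 1 - z.2).
have [M hM] := cont_on_bounded cK.1 lg.1.
have [L [h [w [[cL Lz lh hz'] [Lb Lw lw]]]]] := lower_end_continuum cf nf (z.2 - g z.1 - M - 1) hz.
have lg' : is_lift K f (fun u => g u + (z.2 - g z.1)).
  apply: is_lift_shift => //.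
  have -> : z.2 - g z.1 = (z.2 - f z.1) - (g z.1 - f z.1) by lra.
  by apply: rpredB; [case: hz|case: lg => _; apply].
have e : g z.1 + (z.2 - g z.1) = h z.1 by rewrite hz'; lra.
have [[KL eq]|[LK eq]] := nested_lifts cK cL Kz Lz lg' lh e.
  by have := Lb _ (KL _ Ky); rewrite -eq //; lra.
have := hM _ (LK _ Lw); have := eq _ Lw; rewrite ler_norml => eq1 /andP[? ?].
lra.
Qed.

(** With lifts through [x] rising by at most [M], all their graphs from height [t] stay below [n].
    The graph of a lift descending below [a] is connected, so a clopen [E] through its starting
    point contains it and is not bounded below by [a]. Integrality of [n] provides the countability
    for Baire. *)
Lemma lower_end_intro f x t : cont_mod1 setT f -> t - f x \is a Num.int ->
  down f x -> ~ up f x -> exists n : nat, lower_end f n%:R (x, t).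
Proof.
move=> cf ti dx ux.
have [M hM] : exists M, forall K g y, cpt_conn K -> K x -> is_lift K f g -> K y -> g y - g x <= M.
  apply: contrapT => h; apply: ux => m; apply: contrapT => h'.
  apply: h; exists m => K g y cK Kx lg Ky; rewrite leNgt; apply/negP => l.
  by apply: h'; exists K, g, y; split=> //; exact: ltW.
have M0 : 0 <= M.
  have [K [g [y [cK Kx lg _ _]]]] := dx 0.
  by have := hM K g x cK Kx lg Kx; rewrite subrr.
pose n := Num.bound (`|t| + M).
have tn : t + M <= n%:R.
  have : `|t| + M < n%:R by apply: archi_boundP; rewrite addr_ge0.
  by have := ler_norm t; lra.
exists n; split=> //=; first by lra.
move=> E E1 E2 E3 [a Ea] Ex.
have [K [g [y [cK Kx lg Ky l]]]] := dx (a - t).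
have lg' : is_lift K f (fun u => g u + (t - g x)).
  apply: is_lift_shift => //; have -> : t - g x = (t - f x) - (g x - f x) by lra.
  by apply: rpredB => //; case: lg => _; apply.
have cG := graph_cpt_conn cK lg'.1.
have GE : [set (u, g u + (t - g x)) | u in K] `<=` E.
  apply: (connected_sub_closed cG.2 E1 E2).
  - move=> _ [u Ku <-]; have [Eu|nE] := pselect (E (u, g u + (t - g x))); first by left.
    right; split=> //; split=> /=; first by case: lg' => _; apply.
    by have := hM K g u cK Kx lg Ku; lra.
  - by rewrite -subset0 => u [[_ Eu] []].
  - by exists (x, t); split=> //; exists x => //; congr (_, _); lra.
have := Ea (y, g y + (t - g x)); move=> /(_ _)/=; have -> : g y + (t - g x) = g y - g x + t by lra.
move=> h; have := h _; move=> {}h.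
suff : a < g y - g x + t by lra.
apply: h; have -> : g y - g x + t = g y + (t - g x) by lra.
by apply: GE; exists y.
Qed.

(** A proper subcontinuum [A] joins [x] to some [y] in [O]. A continuum descending from [y] is
    nested with [A], so the larger of the two contains [x] and carries the descent; the offset
    [g y - g x] accounts for the change of base point. *)
Lemma down_everywhere f (O : set X) : cont_mod1 setT f -> ~ liftable setT f ->
  open O -> O !=set0 -> (forall y, O y -> down f y) -> forall x, down f x.
Proof.
move=> cf nf oO [w Ow] dO x; have [/dO//|nOx] := pselect (O x).
have [||||A [cA _ Ax nA [y [Ay Oy]]]] := composant_meets_open hX (conj cX kX) oO (z := x) (w := w) => //.
have [g lg] := proper_liftable cf cA nA; move=> m.
have [K [h [u [cK Ky lh Ku l]]]] := dO _ Oy (m - (g y - g x)).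
have lh' : is_lift K f (fun v => h v + (g y - h y)).
  apply: is_lift_shift => //; have -> : g y - h y = (g y - f y) - (h y - f y) by lra.
  by apply: rpredB; [case: lg => _; apply|case: lh => _; apply].
have e : g y = h y + (g y - h y) by lra.
have [[AK eq]|[KA eq]] := nested_lifts cA cK Ay Ky lg lh' e.
  exists K, h, u; split=> //; first exact: AK.
  by have := eq _ Ax; lra.
exists A, g, u; split=> //; first exact: KA.
by have := eq _ Ku; lra.
Qed.

Theorem not_everywhere_one_way f : cont_mod1 setT f -> ~ liftable setT f ->
  ~ forall x, one_way f x.
Proof.
move=> cf nf one.
have cN := cont_mod1N cf.
have nN : ~ liftable setT (fun x => - f x) by move=> /liftableN.
have [x0 _] : [set: X] !=set0.
  apply: contrapT => h; apply: nf; exists f; split=> x _.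
    by exfalso; apply: h; exists x.
  by exfalso; apply: h; exists x.
(* Every fibre meets heights 0 to 1, so restricting to this compact strip loses no point of [X] and
   makes the projection closed. *)
pose P (g : X -> R) n : set X := fst @` (lower_end g n%:R `&` [set z | 0 <= z.2] `&` [set z | z.2 <= 1]).
have P_closed (g : X -> R) n : cont_mod1 setT g -> closed (P g n).
  move=> cg; apply: (compact_closed hX); apply: continuous_compact.
    by apply: continuous_subspaceT => z; exact: cvg_fst.
  apply: (compact_strip (a := 0) (b := 1) cX).
    apply: closedI; last exact: closed_below.
    by apply: closedI; [exact: lower_end_closed|exact: closed_above].
  by move=> z [[_ /= -> /= ->]].
have P_down (g : X -> R) n x : cont_mod1 setT g -> ~ liftable setT g -> P g n x -> down g x.
  by move=> cg ng [z [[hz _] _] <-]; exact: lower_end_down hz.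
have P_cover (g : X -> R) x : cont_mod1 setT g -> down g x -> ~ up g x -> exists n, P g n x.
  move=> cg dx ux; pose t := g x - (Num.floor (g x))%:~R.
  have ti : t - g x \is a Num.int by rewrite /t addrAC subrr add0r rpredN intr_int.
  have [n hn] := lower_end_intro cg ti dx ux.
  exists n, (x, t) => //; split; [split=> //=|] => /=.
    by rewrite /t subr_ge0 ge_floor.
  by rewrite /t; have := lt_succ_floor (g x); rewrite intrD; lra.
have no_interior (g : X -> R) n (O : set X) : cont_mod1 setT g -> ~ liftable setT g ->
    open O -> O !=set0 -> O `<=` P g n -> False.
  move=> cg ng oO O0 OP.
  (* Descent would hold everywhere, whereas the lower end of [- g] supplies a point from which [- g]
     does not rise, that is, [g] does not descend. *)
  have dg := down_everywhere cg ng oO O0 (fun y Oy => P_down g n y cg ng (OP _ Oy)).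
  have cg' := cont_mod1N cg.
  have ng' : ~ liftable setT (fun x => - g x) by move=> /liftableN.
  have [z hz] := lower_end_nonempty cg' ng' 0.
  exact: (lower_end_not_up cg' ng' hz) ((downN g z.1).2 (dg z.1)).
(* The sets of both types are interleaved in one sequence: even indices for [f], odd ones for
   [- f]. *)
pose F n := if odd n then P (fun x => - f x) n./2 else P f n./2.
have [|||n [O [oO O0 OF]]] := @compact_baire _ _ F hX cX.
- by exists x0.
- by move=> n; rewrite /F; case: odd; exact: P_closed.
- rewrite eqEsubset; split=> // x _; case: (one x) => -[h1 h2].
    have [n hn] := P_cover f x cf h1 h2.
    by exists n.*2 => //; rewrite /F odd_double doubleK.
  have [||n hn] := P_cover (fun x => - f x) x cN.
  + exact/upN.
  + by move/downN.
  by exists n.*2.+1 => //; rewrite /F /= odd_double /= uphalf_double.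
move: OF; rewrite /F; case: odd => OF.
  exact: (no_interior _ _ O cN nN oO O0 OF).
exact: (no_interior _ _ O cf nf oO O0 OF).
Qed.

End composants.

(** * Invariance of types under homeomorphisms *)

Section invariance.
Context {R : realType} {X : pseudoMetricType R}.
Hypothesis hX : hausdorff_space X.
Hypothesis cX : compact [set: X].
Hypothesis kX : connected [set: X].
Hypothesis nested : forall A B : set X, cpt_conn A -> cpt_conn B ->
  A `&` B !=set0 -> A `<=` B \/ B `<=` A.
Hypothesis proper_liftable : forall (f : X -> R) K, cont_mod1 setT f ->
  cpt_conn K -> K <> setT -> liftable K f.
Implicit Types f g h : X -> R.

(** A lift [G] of the combination is bounded on the compact [X], and over [K] the lifts satisfy
    [p * g + q * g' = G] up to a constant. So [g'] equals [r * g] up to a bounded error, with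
    [r = - p / q] positive. *)
Lemma down_dependent f h (p q : R) x : cont_mod1 setT h -> ~ liftable setT f ->
  p \is a Num.int -> q \is a Num.int -> p * q < 0 ->
  liftable setT (fun x => p * f x + q * h x) -> down f x -> down h x.
Proof.
move=> ch nf pi qi pq [G [cG Gi]] dx m.
have [M hM] := cont_on_bounded cX cG.
have q0 : q != 0 by apply: contraTneq pq => ->; rewrite mulr0 ltxx.
pose r := - p / q; have r0 : 0 < r.
  have -> : r = - (p * q) / q ^+ 2 by rewrite /r; field.
  by rewrite divr_gt0 ?oppr_gt0 // exprn_even_gt0.
pose N := `|2 * M / q|.
have [K [g [y [cK Kx lg Ky l]]]] := dx ((m - N) / r).
have nK : K <> setT by move=> e; apply: nf; exists g; rewrite -e.
have [g' lg'] := proper_liftable ch cK nK.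
exists K, g', y; split=> //.
have e : p * g x + q * g' x - G x = p * g y + q * g' y - G y.
  apply: (@int_valued_constant _ _ K (fun z => p * g z + q * g' z - G z)) cK.2 _ _ _ _ Kx Ky.
    have c1 := cont_on_lin p q lg.1 lg'.1.
    have := cont_on_lin 1 (-1) c1 (cont_onS (@subsetT _ K) cG).
    by congr cont_on; apply/funext => z; rewrite mul1r mulN1r.
  move=> z Kz; have -> : p * g z + q * g' z - G z =
     p * (g z - f z) + q * (g' z - h z) - (G z - (p * f z + q * h z)) by lra.
  apply: rpredB; last exact: Gi.
  by apply: rpredD; apply: rpredM => //; [case: lg => _; apply|case: lg' => _; apply].
have -> : g' y - g' x = r * (g y - g x) + (G y - G x) / q.
  have e2 : q * (g' y - g' x) = (G y - G x) - p * (g y - g x) by lra.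
  by apply: (mulfI q0); rewrite e2 /r; field.
move: l; rewrite ler_pdivlMr // mulrC => l.
suff : (G y - G x) / q <= N by lra.
apply: le_trans (ler_norm _) _; rewrite /N !normrM ler_wpM2r //.
have := hM x I; have := hM y I; have := ler_normB (G y) (G x).
by rewrite -normrM; have := ler_norm (2 * M); lra.
Qed.

(** The sign of [p * q] decides whether the two directions are kept or exchanged; passing to [- f]
    or [- h] reduces all cases to [down_dependent]. *)
Lemma one_way_dependent f h (p q : R) x : cont_mod1 setT f -> cont_mod1 setT h ->
  ~ liftable setT f -> ~ liftable setT h ->
  p \is a Num.int -> q \is a Num.int -> p != 0 -> q != 0 ->
  liftable setT (fun x => p * f x + q * h x) -> one_way f x -> one_way h x.
Proof.
move=> cf ch nf nh pi qi p0 q0 L.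
have cf' := cont_mod1N cf; have ch' := cont_mod1N ch.
have nf' : ~ liftable setT (fun x => - f x) by move=> /liftableN.
have nh' : ~ liftable setT (fun x => - h x) by move=> /liftableN.
have E (F : X -> R) : (forall x, F x = p * f x + q * h x) -> liftable setT F.
  by move=> e; have -> : F = fun x => p * f x + q * h x by exact/funext.
have pq0 : p * q != 0 by rewrite mulf_neq0.
have [l|l|e] := ltgtP (p * q) 0; last by rewrite e eqxx in pq0.
- have d1 : down f x -> down h x by apply: (@down_dependent f h p q).
  have d2 : down h x -> down f x.
    by apply: (@down_dependent h f q p); rewrite 1?mulrC //; apply: E => z; lra.
  have u1 : up f x -> up h x.
    move=> /upN u; apply/upN; move: u; apply: (@down_dependent _ _ (- p) (- q)); rewrite ?rpredN ?mulrNN //.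
    by apply: E => z; lra.
  have u2 : up h x -> up f x.
    move=> /upN u; apply/upN; move: u; apply: (@down_dependent _ _ (- q) (- p)); rewrite ?rpredN ?mulrNN // 1?mulrC //.
    by apply: E => z; lra.
  by rewrite /one_way; tauto.
- have l' : p * - q < 0 by rewrite mulrN oppr_lt0.
  have l2 : q * - p < 0 by rewrite mulrN oppr_lt0 mulrC.
  have d1 : down f x -> up h x.
    move=> d; apply/upN; move: d; apply: (@down_dependent _ _ p (- q)); rewrite ?rpredN //.
    by apply: E => z; lra.
  have d2 : down h x -> up f x.
    move=> d; apply/upN; move: d; apply: (@down_dependent _ _ q (- p)); rewrite ?rpredN //.
    by apply: E => z; lra.
  have u1 : up f x -> down h x.
    move=> /upN; apply: (@down_dependent _ _ (- p) q); rewrite ?rpredN // 1?mulrC //.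
    by apply: E => z; lra.
  have u2 : up h x -> down f x.
    move=> /upN; apply: (@down_dependent _ _ (- q) p); rewrite ?rpredN // 1?mulrC //.
    by apply: E => z; lra.
  by rewrite /one_way; tauto.
Qed.

Lemma cont_mod1_comp f (k : X -> X) : continuous k -> cont_mod1 setT f -> cont_mod1 setT (f \o k).
Proof. by move=> ck cf x _ e e0; exact: (ck x _ (cf (k x) I e e0)). Qed.

Lemma is_lift_comp f g (K L : set X) (k : X -> X) : continuous k ->
  (forall x, L x -> K (k x)) -> is_lift K f g -> is_lift L (f \o k) (g \o k).
Proof.
move=> ck LK [cg gi]; split=> x Lx; last exact: gi (LK _ Lx).
move=> e e0; have H : \forall y \near x, K (k y) -> `|g (k y) - g (k x)| < e.
  exact: (ck x _ (cg (k x) (LK _ Lx) e e0)).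
by apply: filterS H => y h /LK/h.
Qed.

Lemma down_comp f (k : X -> X) x : homeomorphism k -> down f (k x) -> down (f \o k) x.
Proof.
move=> [ck [k' [ck' kk' k'k]]] d m; have [K [g [y [[cK kK] Kx lg Ky l]]]] := d m.
exists (k' @` K), (g \o k), (k' y); split.
- split.
    by apply: continuous_compact => //; exact: continuous_subspaceT.
  by apply: connected_continuous_connected => //; exact: continuous_subspaceT.
- by exists (k x).
- by apply: is_lift_comp lg => // _ [u Ku <-]; rewrite k'k.
- by exists y.
- by rewrite /= k'k.
Qed.

Lemma one_way_comp f (k : X -> X) x : homeomorphism k -> one_way f (k x) -> one_way (f \o k) x.
Proof.
move=> hk; have [ck [k' [ck' kk' k'k]]] := hk.
have hk' : homeomorphism k' by split=> //; exists k.
have back F : down (F \o k) x -> down F (k x).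
  rewrite -{1}[x]kk' => /(down_comp hk'); congr (down _ _).
  by apply/funext => u /=; rewrite k'k.
have u1 : up f (k x) -> up (f \o k) x by move=> /upN/(down_comp hk)/upN.
have u2 : up (f \o k) x -> up f (k x) by move=> /upN/(back (fun x => - f x))/upN.
have d1 := @down_comp f k x hk; have d2 := @back f.
by rewrite /one_way; tauto.
Qed.

(** A one-way point [x0] exists. If [k] takes [x] to [x0], then [x] is one-way for [f \o k], which
    is again essential; dependence on [f] makes [x] one-way for [f]. *)
Lemma not_homogeneous_of_essential f : cont_mod1 setT f -> ~ liftable setT f ->
  (forall g h, cont_mod1 setT g -> cont_mod1 setT h ->
     ~ liftable setT g -> ~ liftable setT h ->
     exists p q, [/\ p \is a Num.int, q \is a Num.int, p != 0, q != 0 &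
       liftable setT (fun x => p * g x + q * h x)]) ->
  ~ homogeneous X.
Proof.
move=> cf nf dep hom.
have [[x0 t0] hz] := lower_end_nonempty cX cf nf 0.
have one0 : one_way f x0.
  left; split; first exact: lower_end_down hz.
  exact: lower_end_not_up hz.
apply: (not_everywhere_one_way hX cX kX nested proper_liftable cf nf) => x.
have [k [hk kx]] := hom x x0.
have one1 : one_way (f \o k) x by apply: one_way_comp; rewrite ?kx.
have [ck [k' [ck' kk' k'k]]] := hk.
have ck1 := cont_mod1_comp ck cf.
have nk : ~ liftable setT (f \o k).
  move=> [g lg]; apply: nf; exists (g \o k').
  have -> : f = (f \o k) \o k' by apply/funext => u /=; rewrite k'k.
  exact: is_lift_comp lg.
have [p [q [pi qi p0 q0 L]]] := dep _ _ ck1 cf nk nf.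
exact: one_way_dependent L one1.
Qed.

End invariance.

(** * The angle in the plane *)

(** Take the representative of [f x] closest to the lift of [h]; nearby values then differ by at
    most 1/8 + 1/4 + 1/8 = 1/2. *)
Lemma lift_perturb (R : realType) (X : topologicalType) (K : set X) (f h : X -> R) :
  cont_mod1 K f -> liftable K h ->
  (forall x, K x -> near_int (1/8) (f x - h x)) -> liftable K f.
Proof.
move=> cf [g [cg gi]] fh.
have /choice[s sP] : forall x, exists s, K x -> s - f x \is a Num.int /\ `|s - g x| < 1/8.
  move=> x; have [Kx|] := pselect (K x); last by exists 0.
  have [|s s1 s2] := @near_int_rep _ (1/8) (f x) (g x); last by exists s.
  have -> : f x - g x = (f x - h x) - (g x - h x) by lra.
  by apply: near_int_addint; [rewrite rpredN; exact: gi|exact: fh].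
exists s; apply: lift_intro => // [x /sP[]//|x Kx].
have h4 : 0 < 1/4 :> R by lra.
apply: filterS (cg x Kx _ h4) => y hy Ky.
have [_] := sP _ Kx; have [_] := sP _ Ky; have := hy Ky; rewrite !ltr_norml.
move=> /andP[? ?] /andP[? ?] /andP[? ?]; rewrite ler_norml; apply/andP; split; lra.
Qed.

Lemma near_continuous (R : realType) (X : topologicalType) (g : X -> R) x (e : R) :
  {for x, continuous g} -> 0 < e -> \forall y \near x, `|g y - g x| < e.
Proof.
move=> cg e0; have /cvgrPdist_lt/(_ e e0) := cg.
by apply: filterS => y; rewrite distrC.
Qed.

Section angle.
Context {R : realType}.
Local Notation P := (R * R)%type.
Implicit Types w z : P.

Definition l1norm w := `|w.1| + `|w.2|.

(** The unsigned angle to the positive horizontal axis, from 0 to 1/2; on an l1 circle it is affine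
    in the first coordinate. *)
Definition turn w := (1 - w.1 / l1norm w) / 4.

(* The l1 polar angle, measured in full turns; it jumps by 1 across the negative
   horizontal axis. *)
Definition angle w := if 0 <= w.2 then turn w else - turn w.

Lemma l1norm_gt0 w : w != 0 -> 0 < l1norm w.
Proof.
move=> w0; rewrite lt_def addr_ge0 // andbT; apply: contra w0.
rewrite paddr_eq0 // !normr_eq0 => /andP[/eqP a /eqP b].
by apply/eqP; case: w a b => x y /= -> ->.
Qed.

Lemma l1norm_continuous : continuous l1norm.
Proof.
move=> w; apply: cvgD; apply: cvg_norm; [exact: cvg_fst|exact: cvg_snd].
Qed.

Lemma turn_continuous w : w != 0 -> {for w, continuous turn}.
Proof.
move=> w0; apply: cvgM; last exact: cvg_cst.
apply: cvgB; first exact: cvg_cst.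
apply: cvgM; first exact: cvg_fst.
apply: cvgV; last exact: l1norm_continuous.
by rewrite gt_eqF // l1norm_gt0.
Qed.

(** On the axis [turn] is 0 or 1/2, so the two branches of [angle] agree there modulo 1. *)
Lemma turn_axis w : w != 0 -> w.2 = 0 -> turn w *+ 2 \is a Num.int.
Proof.
move=> w0 e; have := l1norm_gt0 w0; rewrite /turn /l1norm e normr0 addr0.
have [h|h] := leP 0 w.1.
  rewrite ger0_norm // => l; rewrite divff ?gt_eqF // subrr mul0r mul0rn.
  exact: rpred0.
rewrite ltr0_norm // => l; have -> : (1 - w.1 / - w.1) / 4 *+ 2 = 1.
  by field; rewrite lt_eqF.
exact: rpred1.
Qed.

Lemma angle_cont_mod1 w : w != 0 -> forall e, 0 < e ->
  \forall v \near w, near_int e (angle v - angle w).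
Proof.
move=> w0 e e0.
have ht := near_continuous (turn_continuous w0) e0.
have [h|h|h] := ltgtP w.2 0.
- have hn : \forall v \near w, v.2 < 0.
    have : \forall t \near w.2, t < 0 by exact: lt_nbhsl.
    exact: (@cvg_snd _ _ (nbhs w.1) (nbhs w.2)).
  apply: filterS2 ht hn => v hv vn; rewrite /angle !leNgt vn h /=.
  by exists 0; rewrite ?rpred0 // subr0 -opprD normrN.
- have hn : \forall v \near w, 0 < v.2.
    have : \forall t \near w.2, 0 < t by exact: lt_nbhsr.
    exact: (@cvg_snd _ _ (nbhs w.1) (nbhs w.2)).
  apply: filterS2 ht hn => v hv vn; rewrite /angle !ltW //=.
  by exists 0; rewrite ?rpred0 // subr0.
- apply: filterS ht => v hv; rewrite /angle h lexx.
  case: ifP => _; first by exists 0; rewrite ?rpred0 // subr0.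
  exists (- (turn w *+ 2)); first by rewrite rpredN turn_axis.
  rewrite -normrN; congr (`|_| < _) : hv; lra.
Qed.

(** Parametrize the upper and lower halves of the l1 circle by [u], with [s] equal to 1 or -1. From
    [u = r] to [u = - r] a lift would change by 1/2 along the upper half and by -1/2 along the lower
    one, with the same endpoints. *)
Lemma angle_not_liftable (r : R) : 0 < r -> ~ liftable [set w | l1norm w = r] angle.
Proof.
move=> r0 [g [cg gi]]; pose I := `[- r, r]%classic : set R.
have kI : connected I by exact: segment_connected.
have side (s : R) : s = 1 \/ s = -1 ->
    cont_on I (fun u => g (u, s * (r - `|u|)) - s * ((1 - u / r) / 4)).
  move=> hs.
  have c1 : cont_on I (fun u => g (u, s * (r - `|u|))).
    move=> u Iu e e0.
    have onS v : I v -> l1norm (v, s * (r - `|v|)) = r.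
      rewrite /I /= in_itv /= => /andP[a b]; rewrite /l1norm /= normrM.
      have -> : `|s| = 1 by case: hs => ->; rewrite ?normrN normr1.
      by rewrite mul1r ger0_norm ?subrKC // subr_ge0 ler_norml a.
    have c : {for u, continuous (fun u => (u, s * (r - `|u|)))}.
      apply: (@cvg_pair _ _ _ _ (nbhs u) (nbhs (s * (r - `|u|)))); first exact: cvg_id.
      apply: cvgM; first exact: cvg_cst.
      by apply: cvgB; [exact: cvg_cst|apply: cvg_norm; exact: cvg_id].
    have H := c _ (cg _ (onS _ Iu) e e0).
    have {}H : \forall v \near u, l1norm (v, s * (r - `|v|)) = r ->
       `|g (v, s * (r - `|v|)) - g (u, s * (r - `|u|))| < e by exact: H.
    by apply: filterS H => v h /onS/h.
  have c2 : cont_on I (fun u => (1 - u / r) / 4).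
    apply/cont_onP; apply: continuous_subspaceT => u.
    apply: cvgM; last exact: cvg_cst.
    apply: cvgB; first exact: cvg_cst.
    by apply: cvgM; [exact: cvg_id|exact: cvg_cst].
  have := cont_on_lin 1 (- s) c1 c2; congr cont_on; apply/funext => u.
  by rewrite mul1r mulNr.
have Ir : I r by rewrite /I /= in_itv /=; apply/andP; split; lra.
have INr : I (- r) by rewrite /I /= in_itv /=; apply/andP; split; lra.
have gS (s u : R) : s = 1 \/ s = -1 -> I u ->
    g (u, s * (r - `|u|)) - s * ((1 - u / r) / 4) \is a Num.int.
  rewrite /I /= in_itv /= => hs /andP[a b].
  have u1 : 0 <= r - `|u| by rewrite subr_ge0 ler_norml a.
  have lr : l1norm (u, s * (r - `|u|)) = r.
    rewrite /l1norm /= normrM.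
    have -> : `|s| = 1 by case: hs => ->; rewrite ?normrN normr1.
    by rewrite mul1r ger0_norm ?subrKC.
  have := gi _ lr; rewrite /angle /turn lr /=.
  case: ifP => [s0|/negbT]; last first.
    rewrite -ltNge; case: hs => -> l; first by rewrite mul1r ltNge u1 in l.
    by rewrite !mulN1r.
  case: hs s0 lr => -> s0 lr; first by rewrite !mul1r.
  (* Only an endpoint of the lower half is left; there [angle] takes the upper branch, and
     [turn_axis] supplies the integer correction. *)
  have ur : r - `|u| = 0 by apply/eqP; rewrite eq_le u1 andbT; lra.
  have w0 : (u, 0) != 0 :> P.
    apply/eqP => -[u0]; have : `|u| = r by lra.
    by rewrite u0 normr0 => e; rewrite e ltxx in r0.
  have := turn_axis w0 erefl; rewrite /turn /l1norm /= normr0 addr0.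
  have -> : `|u| = r by lra.
  move=> t i; have := rpredD i t; set A := g _; set B := (_ / 4) => h.
  by have -> : A - -1 * B = A - B + B *+ 2 by lra.
have e1 := int_valued_constant kI (side 1 (or_introl erefl)) (fun u Iu => gS 1 u (or_introl erefl) Iu) Ir INr.
have e2 := int_valued_constant kI (side (-1) (or_intror erefl)) (fun u Iu => gS (-1) u (or_intror erefl) Iu) Ir INr.
move: e1 e2 => /=; rewrite normrN (ger0_norm (ltW r0)) subrr !mulr0 mulNr divff ?gt_eqF //.
lra.
Qed.

Definition square (r : R) : set P := [set w | `|w.1| <= r /\ `|w.2| <= r].

Lemma square_compact r : compact (square r).
Proof.
have -> : square r = `[- r, r] `*` `[- r, r].
  by rewrite eqEsubset; split=> w; rewrite /square /= !in_itv /= !ler_norml => -[].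
by apply: compact_setX; exact: segment_compact.
Qed.

(** Contract the square to the origin in [N] steps, each changing [f] by less than 1/8 modulo 1, and
    carry a lift from the constant map back to [f] by [lift_perturb]. *)
Lemma square_liftable (f : P -> R) r : cont_mod1 setT f -> liftable (square r) f.
Proof.
move=> cf; have [r0|r0] := ltP r 0.
  by exists f; split=> w [h _]; have := le_lt_trans h r0; rewrite ltNge normr_ge0.
have [||e e0 he] := @cont_mod1_uniform _ _ (square r) f (1/8) (@square_compact r).
- exact: cont_mod1S cf.
- by lra.
pose N := Num.bound (r / e).
have rN : r < e * N%:R.
  by rewrite mulrC -ltr_pdivrMr //; apply: archi_boundP; rewrite divr_ge0 // ltW.
have N0 : 0 < N%:R :> R by rewrite -(pmulr_rgt0 _ e0); exact: le_lt_trans rN.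
pose scale (t : R) w : P := (t * w.1, t * w.2).
have cscale t : continuous (scale t).
  move=> w; apply: (@cvg_pair _ _ _ _ (nbhs (t * w.1)) (nbhs (t * w.2))).
    by apply: cvgM; [exact: cvg_cst|exact: cvg_fst].
  by apply: cvgM; [exact: cvg_cst|exact: cvg_snd].
have sc t w : 0 <= t <= 1 -> square r w -> square r (scale t w).
  move=> /andP[t0 t1] [a b]; rewrite /square /= !normrM (ger0_norm t0).
  by split; apply: le_trans (ler_piMl _ t1) _.
suff H k : (k <= N)%N -> liftable (square r) (f \o scale (k%:R / N%:R)).
  have := H N (leqnn _); rewrite divff ?gt_eqF //; congr liftable.
  by apply/funext => -[x y]; rewrite /scale /= !mul1r.
elim: k => [_|k IH kN].
  exists (fun=> f (0, 0)); split=> [|w _]; first exact: cont_on_cst.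
  by rewrite /scale /= !mul0r subrr rpred0.
apply: (@lift_perturb _ _ _ _ (f \o scale (k%:R / N%:R))).
- apply: cont_mod1S (@subsetT _ _) _ => w _ d d0.
  by have := cscale (k.+1%:R / N%:R) w _ (cf _ I d d0).
- by apply: IH; exact: ltnW.
- move=> w sw; apply: he.
  + by apply: sc sw; rewrite divr_ge0 //= ler_pdivrMr // mul1r ler_nat.
  + by apply: sc sw; rewrite divr_ge0 //= ler_pdivrMr // mul1r ler_nat ltnW.
  + have small u : `|u| <= r -> `|k.+1%:R / N%:R * u - k%:R / N%:R * u| < e.
      move=> ur; rewrite -mulrBl -mulrBl -natr1 addrAC subrr add0r mul1r normrM.
      rewrite gtr0_norm ?invr_gt0 // mulrC ltr_pdivrMr //.
      exact: le_lt_trans rN.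
    by case: sw => a b; split; apply: small.
Qed.

End angle.

(** * Separation of the plane and essential angles *)

Section plane.
Context {R : realType}.
Local Notation P := (R * R)%type.
Implicit Types w z : P.

Lemma convex_connected (H : set P) :
  (forall w v t, H w -> H v -> 0 <= t <= 1 ->
     H (w.1 + t * (v.1 - w.1), w.2 + t * (v.2 - w.2))) -> connected H.
Proof.
move=> cvx; have [[w0 Hw0]|H0] := pselect (H !=set0); last first.
  have -> : H = set0 by rewrite -subset0 => w Hw; apply: H0; exists w.
  exact: connected0.
pose s v (t : R) : P := (w0.1 + t * (v.1 - w0.1), w0.2 + t * (v.2 - w0.2)).
have cs v : continuous (s v).
  move=> t; apply: (@cvg_pair _ _ _ _ (nbhs (s v t).1) (nbhs (s v t).2)).
    by apply: cvgD; [exact: cvg_cst|apply: cvgM; [exact: cvg_id|exact: cvg_cst]].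
  by apply: cvgD; [exact: cvg_cst|apply: cvgM; [exact: cvg_id|exact: cvg_cst]].
have -> : H = \bigcup_(v in H) (s v @` `[0, 1]).
  rewrite eqEsubset; split=> [v Hv|w [v Hv [t]]].
    exists v => //; exists 1; first by rewrite /= in_itv /= ler01 lexx.
    by rewrite /s !mul1r !subrKC; case: (v).
  by rewrite /= in_itv /= => t01 <-; exact: cvx.
apply: bigcup_connected.
  exists w0 => v Hv; exists 0; first by rewrite /= in_itv /= ler01 lexx.
  by rewrite /s !mul0r !addr0; case: (w0).
move=> v Hv; apply: connected_continuous_connected; first exact: segment_connected.
exact: continuous_subspaceT.
Qed.

Lemma square_exterior_connected (r : R) : 0 <= r -> connected (~` square r : set P).
Proof.
move=> r0.
have -> : ~` square r = [set w : P | r < w.1] `|` [set w | r < w.2] `|` [set w | w.1 < - r]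
    `|` [set w | w.2 < - r].
  rewrite eqEsubset; split=> w; rewrite /square /=.
    move=> h; apply: contrapT => n; apply: h; rewrite !ler_norml.
    by split; apply/andP; split; rewrite leNgt; apply/negP => l; apply: n; tauto.
  move=> h [/= h1 h2]; move: h1 h2; rewrite !ler_norml => /andP[? ?] /andP[? ?].
  by move: h => [[[|]|]|] /= h; lra.
have cvx (a b t : R) : r < a -> r < b -> 0 <= t <= 1 -> r < a + t * (b - a).
  by move=> ? ? /andP[? ?]; have [ab|/ltW ab] := leP a b; nra.
have cvxN (a b t : R) : a < - r -> b < - r -> 0 <= t <= 1 -> a + t * (b - a) < - r.
  by move=> ? ? /andP[? ?]; have [ab|/ltW ab] := leP a b; nra.
have c1 : connected [set w : P | r < w.1] by apply: convex_connected => w v t; exact: cvx.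
have c2 : connected [set w : P | r < w.2] by apply: convex_connected => w v t; exact: cvx.
have c3 : connected [set w : P | w.1 < - r] by apply: convex_connected => w v t; exact: cvxN.
have c4 : connected [set w : P | w.2 < - r] by apply: convex_connected => w v t; exact: cvxN.
apply: connectedU => //.
  by exists (r + 1, - r - 1); split=> /=; [left; left|]; lra.
apply: connectedU => //.
  by exists (- r - 1, r + 1); split=> /=; [right|]; lra.
by apply: connectedU => //; exists (r + 1, r + 1); split=> /=; lra.
Qed.

(* If the angle about a point of a bounded complementary domain A lifted to C,
   then by Tietze's theorem it could be redefined on A so as to become continuous
   modulo 1 on the whole plane, and so would lift to any large square. *)
Lemma essential_angle (C : set P) : compact C -> ~ connected (~` C) ->
  exists z, ~ C z /\ ~ liftable C (fun x => angle (x - z)).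
Proof.
move=> cC /connectedPn[E [E0 EU Esep]].
have clC : closed C by apply: compact_closed => //; exact: norm_hausdorff.
have oC : open (~` C) by exact: closed_openC.
have [r r0 Cr] : exists2 r, 0 < r & C `<=` square r.
  have c1 : continuous (@fst R R) by move=> x; exact: cvg_fst.
  have c2 : continuous (@snd R R) by move=> x; exact: cvg_snd.
  have [M1 h1] := cont_on_bounded cC ((cont_onP _ _).2 (continuous_subspaceT c1)).
  have [M2 h2] := cont_on_bounded cC ((cont_onP _ _).2 (continuous_subspaceT c2)).
  exists (`|M1| + `|M2| + 1); first by rewrite ltr_wpDl // addr_ge0.
  move=> x Cx; have := h1 x Cx; have := h2 x Cx.
  have := ler_norm M1; have := ler_norm M2; have := normr_ge0 M1; have := normr_ge0 M2.
  by rewrite /square /=; lra.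
have Ext : ~` square r `<=` E false `|` E true by rewrite -EU; exact: subsetC.
have [oF oT] : open (E false) /\ open (E true).
  have key (A B : set P) : ~` C = A `|` B -> separated A B -> open A.
    move=> e [s1 s2]; have -> : A = ~` C `&` ~` closure B.
      rewrite eqEsubset; split=> x.
        move=> Ax; split; first by rewrite e; left.
        by move=> Bx; have : set0 x by rewrite -s2.
      by rewrite e => -[[//|Bx]] /(_ (subset_closure Bx)).
    by apply: openI => //; apply: closed_openC; exact: closed_closure.
  split; first exact: key EU Esep.
  by apply: key (_ : _ = E true `|` E false) _; rewrite 1?setUC // separatedC.
have dE := separated_disjoint Esep.
(* The connected exterior of the square lies on one side of the separation; [A] is the other side,
   hence bounded, and [z] is taken in it. *)
have [A [B [oA oB [z Az] AB0 [ABU XB]]]] : exists A B : set P,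
    [/\ open A, open B, A !=set0, A `&` B = set0 & ~` C = A `|` B /\ ~` square r `<=` B].
  case: (connected_subset Esep Ext (square_exterior_connected (ltW r0))) => h.
    by exists (E true), (E false); split=> //; rewrite 1?setIC // setUC.
  by exists (E false), (E true).
have nC x : A x -> ~ C x.
  by move=> Ax; have : (~` C) x by rewrite ABU; left.
have Asq : A `<=` square r.
  move=> x Ax; apply: contrapT => nx; have : set0 x by rewrite -AB0; split=> //; exact: XB.
  by [].
exists z; split; first exact: nC.
move=> [th [cth thi]].
have [M hM] := cont_on_bounded cC cth.
have M0 : 0 < `|M| + 1 by rewrite ltr_wpDl.
have thM x : C x -> `|th x| <= `|M| + 1.
  by move=> /hM; have := ler_norm M; lra.
have [T [Tth cT _]] := continuous_bounded_extension (@pseudometric_normal R P) clC M0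
  ((cont_onP _ _).1 cth) thM.
have eT x : C x -> T x = th x by move=> Cx; rewrite Tth // inE.
(* The frontier of [A] lies in [C], where [T] and the angle differ by integers; outside [A] the
   angle is continuous modulo 1, since [z] is in [A]. *)
pose psi x := if pselect (A x) then T x else angle (x - z).
have psiA x : A x -> psi x = T x by rewrite /psi; case: pselect.
have psiN x : ~ A x -> psi x = angle (x - z) by rewrite /psi; case: pselect.
have angle_near x : ~ A x -> forall e, 0 < e ->
    \forall y \near x, near_int e (angle (y - z) - angle (x - z)).
  move=> nA e e0; have xz : x - z != 0 by rewrite subr_eq0; apply: contraPneq nA => ->.
  have cs : {for x, continuous (fun y : P => y - z)} by apply: cvgB; [exact: cvg_id|exact: cvg_cst].
  by have := cs _ (angle_cont_mod1 xz e0).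
have cpsi : cont_mod1 setT psi.
  move=> x _ e e0; have [Ax|nAx] := pselect (A x).
    have nA : \forall y \near x, A y by exact: open_nbhs_nbhs.
    apply: filterS2 nA (near_continuous (cT x) e0) => y Ay h _.
    by rewrite !psiA //; exists 0; rewrite ?rpred0 // subr0.
  rewrite (psiN _ nAx); have [Cx|nCx] := pselect (C x).
    apply: filterS2 (near_continuous (cT x) e0) (angle_near _ nAx _ e0) => y h1 h2 _.
    have [Ay|nAy] := pselect (A y); last by rewrite psiN.
    rewrite psiA //; have -> : T y - angle (x - z) = T y - T x + (th x - angle (x - z)).
      by rewrite (eT _ Cx) addrA subrK.
    apply: near_int_addint; first exact: thi.
    by exists 0; rewrite ?rpred0 // subr0.
  have nB : \forall y \near x, B y.
    apply: open_nbhs_nbhs; split=> //; have : (~` C) x by [].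
    by rewrite ABU => -[].
  apply: filterS2 nB (angle_near _ nAx _ e0) => y By h _.
  by rewrite psiN // => Ay; have : set0 y by rewrite -AB0.
(* The l1 circle of this radius about [z] avoids the square around [A], so [psi] is the angle on
   it. *)
pose rho := 2 * (r + `|z.1| + `|z.2| + 1).
have rho0 : 0 < rho.
  by have := normr_ge0 z.1; have := normr_ge0 z.2; rewrite /rho; lra.
have cz : continuous (fun x : P => x + z).
  by move=> x; apply: cvgD; [exact: cvg_id|exact: cvg_cst].
have cpz : cont_mod1 setT (fun x : P => psi (x + z)).
  by move=> x _ e e0; have := cz x _ (cpsi (x + z) I e e0).
have [g [cg gi]] := square_liftable rho cpz.
apply: (angle_not_liftable rho0); exists g.
have sub : [set w : P | l1norm w = rho] `<=` square rho.
  move=> w /= e; rewrite /square /= -e /l1norm.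
  by have := normr_ge0 w.1; have := normr_ge0 w.2; lra.
split; first exact: cont_onS sub cg.
move=> w ew; have nA : ~ A (w + z).
  move=> /Asq[/= h1 h2]; move: ew; rewrite /= /l1norm => ew.
  have := ler_normB (w.1 + z.1) z.1; have := ler_normB (w.2 + z.2) z.2.
  by rewrite !addrK; move: ew; rewrite /rho; have := normr_ge0 z.1; have := normr_ge0 z.2; lra.
have := gi w (sub _ ew); rewrite psiN //.
by have -> : w + z - z = w by rewrite addrK.
Qed.

End plane.

(** * The pseudo-circle *)

Section subtype.
Context {T : topologicalType} (C : set T).

Lemma set_val_continuous : continuous (@set_val T C).
Proof. exact: initial_continuous. Qed.

Lemma set_valC (x : C) : C (set_val x).
Proof. exact: set_valP. Qed.

Lemma set_type_ex c : C c -> exists x : C, set_val x = c.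
Proof. by move=> Cc; exists (exist _ c (mem_set Cc)). Qed.

Lemma open_set_type (B : set C) : open B -> exists2 O, open O & B = set_val @^-1` O.
Proof. by move=> [O oO <-]; exists O. Qed.

Lemma set_type_hausdorff : hausdorff_space T -> hausdorff_space C.
Proof.
move=> hT x y cl; apply: val_inj; apply: hT => A B nA nB.
have [u [Au Bu]] := cl _ _ (set_val_continuous nA) (set_val_continuous nB).
by exists (set_val u).
Qed.

Lemma set_type_compact : compact C -> compact [set: C].
Proof.
move=> cC F PF _.
have [|c [Cc cl]] := cC (set_val @ F) _.
  by apply: (@filterS _ F _ setT) => [x _|]; [exact: set_valC|exact: filterT].
have [x xc] := set_type_ex Cc; exists x; split=> // A B FA.
rewrite nbhsE => -[O [/open_set_type[O' oO' ->] Ox] OB].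
have [||_ [[u Au <-] O'u]] := cl (set_val @` A) O'.
- by apply: (@filterS _ F _ A) => // u Au; exists u.
- by apply: open_nbhs_nbhs; split=> //; rewrite -xc.
by exists u; split=> //; exact: OB.
Qed.

Lemma set_type_connected : connected C -> connected [set: C].
Proof.
move=> kC B [b Bb] [O oO BO] [D cD BD]; rewrite setTI in BO; rewrite setTI in BD.
have [O1 oO1 e1] := open_set_type oO.
have [O2 oO2 e2] := open_set_type (closed_openC cD).
have e : set_val @` B = C.
  apply: kC; first by exists (set_val b); exists b.
    exists O1 => //; rewrite BO e1 eqEsubset; split=> [_ [u Ou <-]|c [Cc Oc]].
      by split=> //; exact: set_valC.
    by have [u uc] := set_type_ex Cc; exists u => //; rewrite /preimage /= uc.
  exists (~` O2); first exact: open_closedC.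
  have eD u : D u <-> ~ O2 (set_val u).
    by rewrite -[O2 _]/((set_val @^-1` O2) u) -e2 /setC /= notK.
  rewrite BD eqEsubset; split=> [_ [u Du <-]|c [Cc Oc]].
    by split; [exact: set_valC|exact/eD].
  by have [u uc] := set_type_ex Cc; exists u => //; apply/eD; rewrite uc.
rewrite eqEsubset; split=> // x _.
by have [u Bu /val_inj <-] : (set_val @` B) (set_val x) by rewrite e; exact: set_valC.
Qed.

Lemma set_val_cpt_conn (A : set C) : cpt_conn A -> cpt_conn (set_val @` A).
Proof.
move=> [cA kA]; have c := continuous_subspaceT (A := A) set_val_continuous.
by split; [exact: continuous_compact|exact: connected_continuous_connected].
Qed.

Lemma set_val_image_sub (A : set C) : set_val @` A `<=` C.
Proof. by move=> _ [x _ <-]; exact: set_valC. Qed.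

Lemma set_val_image_subset (A B : set C) : set_val @` A `<=` set_val @` B -> A `<=` B.
Proof.
move=> AB x Ax; have [|y By /val_inj <-] := AB (set_val x); first by exists x.
by [].
Qed.

End subtype.

(** Otherwise [A] and [B] would be proper subcontinua decomposing their union; [a], [b] and the
    common point [z] also witness nondegeneracy. *)
Lemma hereditarily_indecomposable_nested (T : topologicalType) (C A B : set T) :
  hereditarily_indecomposable C -> cpt_conn A -> cpt_conn B -> A `<=` C -> B `<=` C ->
  A `&` B !=set0 -> A `<=` B \/ B `<=` A.
Proof.
move=> hi [cA kA] [cB kB] AC BC [z [Az Bz]]; apply: contrapT => n.
have [a [Aa nBa]] : exists a, A a /\ ~ B a.
  apply: contrapT => h; apply: n; left => a Aa; apply: contrapT => nB.
  by apply: h; exists a.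
have [b [Bb nAb]] : exists b, B b /\ ~ A b.
  apply: contrapT => h; apply: n; right => b Bb; apply: contrapT => nA.
  by apply: h; exists b.
have cAB : continuum (A `|` B).
  split; first exact: compactU.
    by apply: connectedU => //; exists z.
  by exists a, b; split; [left|right|move=> e; apply: nBa; rewrite e].
apply: (hi (A `|` B)); first by split=> // x [/AC|/BC].
have contA : continuum A.
  by split=> //; exists a, z; split=> // e; apply: nBa; rewrite e.
have contB : continuum B.
  by split=> //; exists b, z; split=> // e; apply: nAb; rewrite e.
exists A, B; split=> //.
- split; first by split=> // x; left.
  by move=> e; apply: nAb; rewrite e; right.
- split; first by split=> // x; right.
  by move=> e; apply: nBa; rewrite e; left.
Qed.

Section links.
Context {R : realType} {V : normedModType R} (C : set V).

Lemma diam_lt_ball (U : set V) e x y : (diam U < e%:E)%E -> U x -> U y -> ball x e y.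
Proof.
move=> dU Ux Uy; rewrite -ball_normE /ball_ /= -lte_fin; apply: le_lt_trans dU.
by apply: ereal_sup_ubound; exists x => //; exists y.
Qed.

Lemma liftable_of_chainable (K : set C) (f : C -> R) : compact K ->
  cont_mod1 K f -> chainable (set_val @` K) -> liftable K f.
Proof.
move=> cK cf ch.
have [|e e0 he] := cont_mod1_uniform cK cf (_ : 0 < 1/8); first by lra.
have [n [U [[oU ovU] KU dU]]] := ch e e0.
pose U' i : set C := set_val @^-1` U i.
have U'K i x : U' i x -> K x.
  have [O _ eO] := oU i; rewrite /U' /= eO => -[[u Ku /val_inj <-] _].
  by [].
have small i x y : K x -> K y -> U' i x -> U' i y -> near_int (1/8) (f x - f y).
  by move=> Kx Ky Ux Uy; apply: he => //; exact: diam_lt_ball (dU i) Ux Uy.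
have ptU i j x : (U i `&` U j) x -> exists2 u : C, K u & U' i u /\ U' j u.
  move=> [Ui Uj]; have [O _ eO] := oU i; move: (Ui); rewrite {1}eO => -[[u Ku eu] _].
  by exists u => //; rewrite /U' /= eu.
(* A chain does not close up, so [W] is [False]; a single map is treated with [h := f], [p = 1] and
   [q = 0]. *)
have [|||||||d [d' [_ _ /(_ 1 0)]]] := @liftable_from_circular_links _ _ K n U' _ _ False f f cf cf.
- by move=> x Kx; have [i _ Ui] := KU _ (imageP _ Kx); exists i.
- move=> i x Kx; have [O oO eO] := oU i; rewrite /U' /= eO => -[_ Ox].
  have : \forall y \near x, O (set_val y).
    by apply: (set_val_continuous (x := x)); exact: open_nbhs_nbhs.
  by apply: filterS => y Oy Ky; split=> //; exists y.
- move=> i; have [x hx] : U i `&` U i !=set0 by apply/ovU; rewrite subrr.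
  by have [u Ku [Uu _]] := ptU i i x hx; exists u.
- move=> i j e1; have [x hx] : U i `&` U j !=set0 by apply/ovU; lia.
  by have [u Ku [Uu Uu']] := ptU i j x hx; exists u.
- by move=> i j x Kx Ui Uj; left; apply/ovU; exists (set_val x).
- exact: small.
- exact: small.
move=> /(_ (rpred1 _) (rpred0 _)) [//|g [cg gi]]; exists g; split=> // x /gi.
by rewrite mul1r mul0r addr0.
Qed.

(** Take [p = d'] and [q = - d]. A vanishing winding number would let the corresponding map lift by
    itself, so both are nonzero. *)
Lemma dependent_of_circularly_chainable (f h : C -> R) : compact [set: C] ->
  cont_mod1 setT f -> cont_mod1 setT h -> circularly_chainable C ->
  ~ liftable setT f -> ~ liftable setT h ->
  exists p q, [/\ p \is a Num.int, q \is a Num.int, p != 0, q != 0 &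
    liftable setT (fun x => p * f x + q * h x)].
Proof.
move=> cC cf ch circ nf nh.
have [|e1 e10 he1] := cont_mod1_uniform cC cf (_ : 0 < 1/8); first by lra.
have [|e2 e20 he2] := cont_mod1_uniform cC ch (_ : 0 < 1/8); first by lra.
have [|n [U [[oU ovU] CU dU]]] := circ (Num.min e1 e2); first by rewrite lt_min e10.
pose U' i : set C := set_val @^-1` U i.
have dU1 i : (diam (U i) < e1%:E)%E.
  by apply: lt_le_trans (dU i) _; rewrite lee_fin ge_min lexx.
have dU2 i : (diam (U i) < e2%:E)%E.
  by apply: lt_le_trans (dU i) _; rewrite lee_fin ge_min lexx orbT.
have ptU i j x : (U i `&` U j) x -> exists2 u : C, setT u & U' i u /\ U' j u.
  move=> [Ui Uj]; have [O _ eO] := oU i; move: (Ui); rewrite {1}eO => -[Cx _].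
  by have [u eu] := set_type_ex Cx; exists u => //; rewrite /U' /= eu.
have [|||||||d [d' [di di' H]]] := @liftable_from_circular_links _ _ setT n U' _ _ True f h cf ch.
- by move=> x _; have [i _ Ui] := CU _ (set_valC x); exists i.
- move=> i x _; have [O oO eO] := oU i; rewrite /U' /= eO => -[_ Ox].
  have : \forall y \near x, O (set_val y).
    by apply: (set_val_continuous (x := x)); exact: open_nbhs_nbhs.
  by apply: filterS => y Oy _; split=> //; exact: set_valC.
- move=> i; have [x hx] : U i `&` U i !=set0 by apply/ovU; apply: Or31; rewrite subrr.
  by have [u Ku [Uu _]] := ptU i i x hx; exists u.
- move=> i j e; have [x hx] : U i `&` U j !=set0 by apply/ovU; apply: Or31; lia.
  by have [u Ku [Uu Uu']] := ptU i j x hx; exists u.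
- move=> i j x _ Ui Uj; have /ovU : U i `&` U j !=set0 by exists (set_val x).
  by case; [left|right; split=> //; left|right; split=> //; right].
- by move=> i x y _ _ Ux Uy; apply: he1 => //; exact: diam_lt_ball (dU1 i) Ux Uy.
- by move=> i x y _ _ Ux Uy; apply: he2 => //; exact: diam_lt_ball (dU2 i) Ux Uy.
exists d', (- d); split=> //.
- by rewrite rpredN.
- apply/eqP => d'0; apply: nh; have := H 0 1 (rpred0 _) (rpred1 _).
  rewrite d'0 mulr0 mul0r addr0 => /(_ (fun=> erefl)) [g [cg gi]].
  by exists g; split=> // x /gi; rewrite mul1r mul0r add0r.
- rewrite oppr_eq0; apply/eqP => d0; apply: nf; have := H 1 0 (rpred1 _) (rpred0 _).
  rewrite d0 mulr0 mul0r addr0 => /(_ (fun=> erefl)) [g [cg gi]].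
  by exists g; split=> // x /gi; rewrite mul1r mul0r addr0.
- by apply: H => //; [rewrite rpredN|move=> _; rewrite mulNr mulrC subrr].
Qed.

End links.

(* The type of points of C carries the library's subspace topology. *)
Theorem theorem1 (R : realType) (C : set (R * R)) (hC : pseudo_circle C) :
  ~ homogeneous (set_type C).
Proof.
case: hC => -[cC kC _] hi circ sep pa.
have hP : hausdorff_space (R * R)%type by apply: hausdorff_prod; exact: Rhausdorff.
have hX := set_type_hausdorff (C := C) hP.
have cX := set_type_compact cC; have kX := set_type_connected kC.
have nested (A B : set C) : cpt_conn A -> cpt_conn B -> A `&` B !=set0 -> A `<=` B \/ B `<=` A.
  move=> cA cB [z [Az Bz]].
  have [|||AB|BA] := hereditarily_indecomposable_nested hi (set_val_cpt_conn cA) (set_val_cpt_conn cB).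
  - exact: set_val_image_sub.
  - exact: set_val_image_sub.
  - by exists (set_val z); split; exists z.
  - by left; exact: set_val_image_subset.
  - by right; exact: set_val_image_subset.
have proper (f : C -> R) K : cont_mod1 setT f -> cpt_conn K -> K <> setT -> liftable K f.
  move=> cf cK nK; have [[x [y [Kx Ky xy]]]|one] := pselect (exists x y, [/\ K x, K y & x <> y]).
    apply: liftable_of_chainable cK.1 (cont_mod1S (@subsetT _ K) cf) _.
    have [cv kv] := set_val_cpt_conn cK.
    have [] // := pa (set_val @` K); split.
      split; last exact: set_val_image_sub.
      split=> //; exists (set_val x), (set_val y).
      by split; [exists x|exists y|move=> /val_inj].
    move=> e; apply: nK; rewrite eqEsubset; split=> // u _.
    have [v Kv /val_inj <-] : (set_val @` K) (set_val u) by rewrite e; exact: set_valC.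
    by [].
  (* Here [K] has at most one point, so [pa] does not apply and [f] is its own lift. *)
  exists f; split=> [x Kx e e0|x _]; last by rewrite subrr rpred0.
  apply: filterS (cf x I _ ltr01) => y _ Ky; have -> : y = x.
    by apply: contrapT => yx; apply: one; exists y, x.
  by rewrite subrr normr0.
have [z [nCz nl]] := essential_angle cC sep.
pose f (x : C) : R := angle (set_val x - z).
have cf : cont_mod1 setT f.
  move=> x _ e e0; have xz : set_val x - z != 0.
    by rewrite subr_eq0; apply/eqP => xz; apply: nCz; rewrite -xz; exact: set_valC.
  have cs : {for set_val x, continuous (fun p : R * R => p - z)}.
    by apply: cvgB; [exact: cvg_id|exact: cvg_cst].
  have H := @set_val_continuous _ C x _ (cs _ (angle_cont_mod1 xz e0)).
  have {}H : \forall y \near x, near_int e (f y - f x) by [].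
  by apply: filterS H.
have nf : ~ liftable setT f.
  move=> [g [cg gi]]; apply: nl.
  (* [nl] concerns functions on the plane, so the lift [g] is carried over from the type of points;
     off [C] any value, here 0, meets the requirement. *)
  have /choice[th hth] : forall c, exists t, forall x : C, set_val x = c -> t = g x.
    move=> c; have [Cc|nC] := pselect (C c).
      by have [x <-] := set_type_ex Cc; exists (g x) => y /val_inj ->.
    by exists 0 => x e; exfalso; apply: nC; rewrite -e; exact: set_valC.
  exists th; split=> c Cc; have [x xc] := set_type_ex Cc; last first.
    by rewrite (hth c x xc) -xc; exact: gi.
  move=> e e0; have /nbhs_ballP[r /= r0 hr] := cg x I e e0.
  apply/nbhs_ballP; exists r => // d cd Cd; have [y yd] := set_type_ex Cd.
  rewrite (hth _ _ xc) (hth _ _ yd); apply: hr => //.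
  by rewrite -yd -xc in cd.
apply: (not_homogeneous_of_essential hX cX kX nested proper cf nf) => g h cg ch ng nh.
exact: dependent_of_circularly_chainable.
Qed.
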